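(* If $\vdash_\sigma P$ and $\langle\sigma;P\rangle\xrightarrow{\mu}\langle\sigma';P'\rangle$, then $\vdash_{\sigma'}P'$.
   Context: Asynchronous $\pi$-calculus: processes $P ::= a\langle\tilde b\rangle \mid\ !a(\tilde b).P \mid P|Q \mid (\nu a)P \mid G$, $G ::= \mathbf 0 \mid a(\tilde b).P \mid \tau.P \mid [a=b]G \mid G+G'$, well-sorted under a fixed sorting; $\xrightarrow{\mu}$ is the standard early LTS of the asynchronous $\pi$-calculus (actions $\tau$, early inputs $a(\tilde b)$, outputs $(\nu\tilde c)a\langle\tilde b\rangle$ with subject $a$); $\mathrm{fn}$ denotes free names. Names: output-controlled ($x,y,z$), input-controlled ($u,v,w$), continuation ($p,q,r$); $a,b,c$ range over output- and input-controlled names. Outputs at output-controlled names carry tuples $\tilde a,p$ ending with exactly one continuation name; continuation names are transmitted only this way. Sequentiality typing (continuation names count as output-controlled): $\vdash_1 u(\tilde a).P$ if $\vdash_1P$; $\vdash_0 x(\tilde a).P$, $\vdash_0 !x(\tilde a).P$ if $\vdash_1P$; $\vdash_1x\langle\tilde a\rangle$; $\vdash_0u\langle\tilde a\rangle$; $\vdash_\eta(\nu a)P$ if $\vdash_\eta P$; $\vdash_0\mathbf0$; $\vdash_{\eta_1+\eta_2}P|Q$ if $\vdash_{\eta_1}P,\vdash_{\eta_2}Q$, $\eta_1+\eta_2\le1$; $\vdash_\eta G_1+G_2$ if $\vdash_\eta G_1,G_2$; $\vdash_\eta\tau.P$ if $\vdash_\eta P$; $\vdash_0[a=b]G$ if $\vdash_0G$.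 Sequential type-allowed transition $\eta\vdash P\xrightarrow{\mu}P'$: $\vdash_\eta P$, $P\xrightarrow{\mu}P'$, and $\eta=0$, or $\mu=\tau$, or $\eta=1$ and $\mu$ is an input at an input-controlled name or an output at an output-controlled name. Stacks: sequences of $p^{\mathrm O}$/$p^{\mathrm I}$ with alternating tags, ending with an output tag unless empty, each name at most once per tag, and if a name has both tags the input occurrence immediately follows the output one; $|\sigma|$ is the length; $\mathrm{seq}(\sigma)=1$ if $\sigma$ starts with an output tag, else $0$. Interleaving $\sigma_1\in\sigma_2\between\sigma_3$: $\sigma_1$ is a stack derivable by $\emptyset\in\emptyset\between\emptyset$, and $t,\sigma_1\in\sigma_2\between t,\sigma_3$, $t,\sigma_1\in t,\sigma_2\between\sigma_3$ from $\sigma_1\in\sigma_2\between\sigma_3$ ($t$ a tagged name). Well-bracketing typing $\vdash_\sigma P$: $\vdash_{p^{\mathrm O}}p\langle\tilde a\rangle$; $\vdash_{p^{\mathrm O}}x\langle\tilde a,p\rangle$; $\vdash_\emptyset u\langle\tilde a\rangle$; $\vdash_{q^{\mathrm I},p^{\mathrm O}}q(\tilde a).P$ if $\vdash_{p^{\mathrm O}}P$, $p\ne q$; $\vdash_\emptyset x(\tilde a,p).P$, $\vdash_\emptyset !x(\tilde a,p).P$ if $\vdash_{p^{\mathrm O}}P$; $\vdash_{p^{\mathrm O}}u(\tilde a).P$ if $\vdash_{p^{\mathrm O}}P$; $\vdash_\emptyset\mathbf0$; $\vdash_{\xi,\sigma'}(\nu p)P$ if $\vdash_{\xi,p^{\mathrm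 O},p^{\mathrm I},\sigma'}P$ with $\xi$ empty or ending with an input tag; $\vdash_\sigma(\nu p)P$ if $\vdash_\sigma P$, $p\notin\sigma$; $\vdash_\sigma(\nu a)P$ if $\vdash_\sigma P$; $\vdash_\emptyset[a=b]P$ if $\vdash_\emptyset P$; $\vdash_{\sigma''}P|Q$ if $\vdash_\sigma P,\vdash_{\sigma'}Q$, $\sigma''\in\sigma\between\sigma'$; $\vdash_\sigma\tau.P$ if $\vdash_\sigma P$, $|\sigma|\le1$; $\vdash_\sigma P+Q$ if $\vdash_\sigma P,Q$, $|\sigma|\le1$. Typed transition $\sigma\vdash P\xrightarrow{\mu}P'$: $\vdash_\sigma P$; $\mathrm{seq}(\sigma)\vdash P\xrightarrow{\mu}P'$; and if a continuation name $p\in\mathrm{fn}(\mu)$ occurs in $\sigma$, then $\sigma=p^{\mathrm O},\sigma'$ or $\sigma=p^{\mathrm I},\sigma'$, and if moreover $p$ occurs in $\sigma'$ then $p$ is not the subject of $\mu$. $\langle\sigma;P\rangle\xrightarrow{\mu}\langle\sigma';P'\rangle$ holds when $\sigma\vdash P\xrightarrow{\mu}P'$ and: (1) if $\mu=(\nu\tilde b)p\langle\tilde a\rangle$ then $\sigma=p^{\mathrm O},\sigma'$; (2) if $\mu=p(\tilde a)$ then $\sigma=p^{\mathrm I},\sigma'$; (3) if $\mu=(\nu\tilde c,p)a\langle\tilde b,p\rangle$ then $\sigma'=p^{\mathrm I},\sigma$; (4) if $\mu=(\nu\tilde c)a\langle\tilde b,p\rangle$ ($p$ not extruded) then $\sigma=p^{\mathrm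 O},\sigma'$; (5) if $\mu=a(\tilde b,p)$ then $\sigma'=p^{\mathrm O},\sigma$; (6) if $\mu=\tau$, then $\sigma'=\sigma''$ when $\sigma=p^{\mathrm O},p^{\mathrm I},\sigma''$ and $p\notin\mathrm{fn}(P')$, and $\sigma'=\sigma$ otherwise.
   Formalization: For visible actions that mention no continuation name (inputs and outputs at input-controlled names), where clauses (1)–(6) do not determine σ′, the transition of configurations is taken to leave the stack unchanged, σ′ = σ; without this the claim fails. *)

(* Defs.v *)
From HB Require Import structures.
From mathcomp Require Import all_boot.

Set Implicit Arguments.
Unset Strict Implicit.
Unset Printing Implicit Defensive.

Variant nkind := KOut | KIn | KCont.

(* [obj s] is the tuple of sorts carried by the names of sort [s]. *)
Record sorting := Sorting {
  srt : eqType;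
  kind : srt -> nkind;
  obj : srt -> seq srt;
  obj_out : forall s, kind s = KOut ->
    exists ss c, [/\ obj s = rcons ss c, kind c = KCont
                   & forall s', s' \in ss -> kind s' <> KCont];
  obj_other : forall s, kind s <> KOut ->
    forall s', s' \in obj s -> kind s' <> KCont
}.

(* Every sort has countably many names. *)
Definition name (S : sorting) : eqType := (srt S * nat)%type.

Definition nsort (S : sorting) (a : name S) : srt S := a.1.

Definition isO (S : sorting) (a : name S) : bool :=
  if kind (nsort a) is KOut then true else false.
Definition isI (S : sorting) (a : name S) : bool :=
  if kind (nsort a) is KIn then true else false.
Definition isC (S : sorting) (a : name S) : bool :=
  if kind (nsort a) is KCont then true else false.
(* The range of the metavariables a, b, c. *)
Definition isA (S : sorting) (a : name S) : bool := ~~ isC a.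

(* Processes up to alpha-conversion: free names are explicit, bound names are
   de Bruijn indices; a binder for a tuple of n names binds the indices
   0, ..., n-1 and records their sorts. All judgements below are phrased with
   the named constructors [out], [inp], [rep], [mtch], [nu], so that terms with
   dangling indices are never well-sorted nor typable. *)
Variant occ (S : sorting) := Fr of name S | Bd of nat.

Inductive proc (S : sorting) :=
| POut of occ S & seq (occ S)
| PRep of occ S & seq (srt S) & proc S
| PPar of proc S & proc S
| PNu of srt S & proc S
| PGrd of grd S
with grd (S : sorting) :=
| GNil
| GIn of occ S & seq (srt S) & proc S
| GTau of proc S
| GMatch of occ S & occ S & grd S
| GSum of grd S & grd S.

Arguments GNil {S}.

Definition fn_occ (S : sorting) (o : occ S) : seq (name S) :=
  if o is Fr a then [:: a] else [::].

Fixpoint fn (S : sorting) (P : proc S) : seq (name S) :=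
  match P with
  | POut a bs => fn_occ a ++ flatten (map (@fn_occ S) bs)
  | PRep a _ P => fn_occ a ++ fn P
  | PPar P Q => fn P ++ fn Q
  | PNu _ P => fn P
  | PGrd G => fn_grd G
  end
with fn_grd (S : sorting) (G : grd S) : seq (name S) :=
  match G with
  | GNil => [::]
  | GIn a _ P => fn_occ a ++ fn P
  | GTau P => fn P
  | GMatch a b G => fn_occ a ++ fn_occ b ++ fn_grd G
  | GSum G G' => fn_grd G ++ fn_grd G'
  end.

(* [ren f P] applies f to the free names of P (no capture can occur). *)
Definition ren_occ (S : sorting) (f : name S -> name S) (o : occ S) : occ S :=
  if o is Fr a then Fr (f a) else o.

Fixpoint ren (S : sorting) (f : name S -> name S) (P : proc S) : proc S :=
  match P with
  | POut a bs => POut (ren_occ f a) (map (ren_occ f) bs)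
  | PRep a ss P => PRep (ren_occ f a) ss (ren f P)
  | PPar P Q => PPar (ren f P) (ren f Q)
  | PNu s P => PNu s (ren f P)
  | PGrd G => PGrd (ren_grd f G)
  end
with ren_grd (S : sorting) (f : name S -> name S) (G : grd S) : grd S :=
  match G with
  | GNil => GNil
  | GIn a ss P => GIn (ren_occ f a) ss (ren f P)
  | GTau P => GTau (ren f P)
  | GMatch a b G => GMatch (ren_occ f a) (ren_occ f b) (ren_grd f G)
  | GSum G G' => GSum (ren_grd f G) (ren_grd f G')
  end.

(* Simultaneous substitution P{cs/bs}, for tuples of the same length:
   a name outside bs has index [size bs] and is left unchanged. *)
Definition psubst (S : sorting) (bs cs : seq (name S)) (P : proc S) : proc S :=
  ren (fun a => nth a cs (index a bs)) P.

(* [close k bs P] turns the free names bs of P into the indices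
   k, ..., k + size bs - 1. *)
Definition close_occ (S : sorting) (k : nat) (bs : seq (name S)) (o : occ S) :
    occ S :=
  match o with
  | Fr a => if a \in bs then Bd S (k + index a bs) else Fr a
  | Bd i => if i < k then Bd S i else Bd S (i + size bs)
  end.

Fixpoint close (S : sorting) (k : nat) (bs : seq (name S)) (P : proc S) :
    proc S :=
  match P with
  | POut a cs => POut (close_occ k bs a) (map (close_occ k bs) cs)
  | PRep a ss P => PRep (close_occ k bs a) ss (close (k + size ss) bs P)
  | PPar P Q => PPar (close k bs P) (close k bs Q)
  | PNu s P => PNu s (close k.+1 bs P)
  | PGrd G => PGrd (close_grd k bs G)
  end
with close_grd (S : sorting) (k : nat) (bs : seq (name S)) (G : grd S) :
    grd S :=
  match G with
  | GNil => GNil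
  | GIn a ss P => GIn (close_occ k bs a) ss (close (k + size ss) bs P)
  | GTau P => GTau (close k bs P)
  | GMatch a b G =>
      GMatch (close_occ k bs a) (close_occ k bs b) (close_grd k bs G)
  | GSum G G' => GSum (close_grd k bs G) (close_grd k bs G')
  end.

Definition out (S : sorting) (a : name S) (bs : seq (name S)) : proc S :=
  POut (Fr a) (map (@Fr S) bs).
Definition inp (S : sorting) (a : name S) (bs : seq (name S)) (P : proc S) :
    grd S :=
  GIn (Fr a) (map (@nsort S) bs) (close 0 bs P).
Definition rep (S : sorting) (a : name S) (bs : seq (name S)) (P : proc S) :
    proc S :=
  PRep (Fr a) (map (@nsort S) bs) (close 0 bs P).
Definition mtch (S : sorting) (a b : name S) (G : grd S) : grd S :=
  GMatch (Fr a) (Fr b) G.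
Definition nu (S : sorting) (a : name S) (P : proc S) : proc S :=
  PNu (nsort a) (close 0 [:: a] P).
Definition nus (S : sorting) (cs : seq (name S)) (P : proc S) : proc S :=
  foldr (@nu S) P cs.

Inductive well_sorted (S : sorting) : proc S -> Prop :=
| ws_out a bs : map (@nsort S) bs = obj (nsort a) -> well_sorted (out a bs)
| ws_rep a bs P : uniq bs -> map (@nsort S) bs = obj (nsort a) ->
    well_sorted P -> well_sorted (rep a bs P)
| ws_par P Q : well_sorted P -> well_sorted Q -> well_sorted (PPar P Q)
| ws_nu a P : well_sorted P -> well_sorted (nu a P)
| ws_nil : well_sorted (PGrd GNil)
| ws_inp a bs P : uniq bs -> map (@nsort S) bs = obj (nsort a) ->
    well_sorted P -> well_sorted (PGrd (inp a bs P))
| ws_tau P : well_sorted P -> well_sorted (PGrd (GTau P))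
| ws_match a b G : well_sorted (PGrd G) -> well_sorted (PGrd (mtch a b G))
| ws_sum G G' : well_sorted (PGrd G) -> well_sorted (PGrd G') ->
    well_sorted (PGrd (GSum G G')).

(* [LOut cs a bs] is the output (nu cs) a<bs>. *)
Variant label (S : sorting) :=
| LTau
| LIn of name S & seq (name S)
| LOut of seq (name S) & name S & seq (name S).

Arguments LTau {S}.

Definition subj (S : sorting) (m : label S) : option (name S) :=
  match m with
  | LTau => None
  | LIn a _ => Some a
  | LOut _ a _ => Some a
  end.

Definition nm_label (S : sorting) (m : label S) : seq (name S) :=
  match m with
  | LTau => [::]
  | LIn a bs => a :: bs
  | LOut cs a bs => cs ++ a :: bs
  end.

Definition bn_label (S : sorting) (m : label S) : seq (name S) :=
  if m is LOut cs _ _ then cs else [::].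

(* Names received by an early input are free. *)
Definition fn_label (S : sorting) (m : label S) : seq (name S) :=
  [seq a <- nm_label m | a \notin bn_label m].

Definition disj (T : eqType) (s t : seq T) : bool := ~~ has (mem t) s.

(* Early transitions. Communication rules also cover scope closing: the
   extruded names cs may be empty. *)
Inductive step (S : sorting) : proc S -> label S -> proc S -> Prop :=
| st_out a bs : step (out a bs) (LOut [::] a bs) (PGrd GNil)
| st_inp a bs cs P : uniq bs -> map (@nsort S) cs = map (@nsort S) bs ->
    step (PGrd (inp a bs P)) (LIn a cs) (psubst bs cs P)
| st_rep a bs cs P : uniq bs -> map (@nsort S) cs = map (@nsort S) bs ->
    step (rep a bs P) (LIn a cs) (PPar (psubst bs cs P) (rep a bs P))
| st_tau P : step (PGrd (GTau P)) LTau P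
| st_match a G m P' : step (PGrd G) m P' -> step (PGrd (mtch a a G)) m P'
| st_suml G G' m P' : step (PGrd G) m P' -> step (PGrd (GSum G G')) m P'
| st_sumr G G' m P' : step (PGrd G') m P' -> step (PGrd (GSum G G')) m P'
| st_parl P Q m P' : step P m P' -> disj (bn_label m) (fn Q) ->
    step (PPar P Q) m (PPar P' Q)
| st_parr P Q m Q' : step Q m Q' -> disj (bn_label m) (fn P) ->
    step (PPar P Q) m (PPar P Q')
| st_comml P Q cs a bs P' Q' : step P (LOut cs a bs) P' ->
    step Q (LIn a bs) Q' -> disj cs (fn Q) ->
    step (PPar P Q) LTau (nus cs (PPar P' Q'))
| st_commr P Q cs a bs P' Q' : step P (LIn a bs) P' ->
    step Q (LOut cs a bs) Q' -> disj cs (fn P) ->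
    step (PPar P Q) LTau (nus cs (PPar P' Q'))
| st_res c P m P' : step P m P' -> c \notin nm_label m ->
    step (nu c P) m (nu c P')
| st_open c P cs a bs P' : step P (LOut cs a bs) P' ->
    c \in bs -> c \notin cs -> c != a ->
    step (nu c P) (LOut (c :: cs) a bs) P'.

(* Sequentiality. Continuation names count as output-controlled, so
   "output-controlled" is ~~ isI here. *)
Inductive seq_typed (S : sorting) : nat -> proc S -> Prop :=
| sq_inI u bs P : isI u -> uniq bs -> seq_typed 1 P ->
    seq_typed 1 (PGrd (inp u bs P))
| sq_inO x bs P : ~~ isI x -> uniq bs -> seq_typed 1 P ->
    seq_typed 0 (PGrd (inp x bs P))
| sq_rep x bs P : ~~ isI x -> uniq bs -> seq_typed 1 P ->
    seq_typed 0 (rep x bs P)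
| sq_outO x bs : ~~ isI x -> seq_typed 1 (out x bs)
| sq_outI u bs : isI u -> seq_typed 0 (out u bs)
| sq_nu eta a P : seq_typed eta P -> seq_typed eta (nu a P)
| sq_nil : seq_typed 0 (PGrd GNil)
| sq_par eta1 eta2 P Q : seq_typed eta1 P -> seq_typed eta2 Q ->
    eta1 + eta2 <= 1 -> seq_typed (eta1 + eta2) (PPar P Q)
| sq_sum eta G1 G2 : seq_typed eta (PGrd G1) -> seq_typed eta (PGrd G2) ->
    seq_typed eta (PGrd (GSum G1 G2))
| sq_tau eta P : seq_typed eta P -> seq_typed eta (PGrd (GTau P))
| sq_match a b G : seq_typed 0 (PGrd G) -> seq_typed 0 (PGrd (mtch a b G)).

Definition seq_allowed (S : sorting) (m : label S) : bool :=
  match m with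
  | LTau => false
  | LIn a _ => isI a
  | LOut _ a _ => ~~ isI a
  end.

Definition seq_step (S : sorting) (eta : nat) (P : proc S) (m : label S)
    (P' : proc S) : Prop :=
  [/\ seq_typed eta P, step P m P'
    & [\/ eta = 0, m = LTau | eta = 1 /\ seq_allowed m]].

Variant tag := TO | TI.
Definition bool_of_tag (t : tag) : bool := if t is TO then true else false.
Definition tag_of_bool (b : bool) : tag := if b then TO else TI.
Lemma bool_of_tagK : cancel bool_of_tag tag_of_bool.
Proof. by case. Qed.
HB.instance Definition _ := Equality.copy tag (can_type bool_of_tagK).

Definition tname (S : sorting) : eqType := (name S * tag)%type.

Definition names (S : sorting) (s : seq (tname S)) : seq (name S) :=
  map fst s.

Record is_stack (S : sorting) (s : seq (tname S)) : Prop := IsStack {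
  stack_cont : all (@isC S) (names s);
  stack_alt : sorted (fun t t' : tname S => t.2 != t'.2) s;
  stack_last : last TO (map snd s) = TO;
  stack_uniq : uniq s;
  stack_next : forall p : name S, (p, TO) \in s -> (p, TI) \in s ->
    infix [:: (p, TO); (p, TI)] s
}.

Definition seq_of (S : sorting) (s : seq (tname S)) : nat :=
  if s is (_, TO) :: _ then 1 else 0.

Inductive shuffle (T : Type) : seq T -> seq T -> seq T -> Prop :=
| sh_nil : shuffle [::] [::] [::]
| sh_r t s1 s2 s3 : shuffle s1 s2 s3 -> shuffle (t :: s1) s2 (t :: s3)
| sh_l t s1 s2 s3 : shuffle s1 s2 s3 -> shuffle (t :: s1) (t :: s2) s3.

Definition interleaving (S : sorting) (s1 s2 s3 : seq (tname S)) : Prop :=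
  is_stack s1 /\ shuffle s1 s2 s3.

Inductive wb_typed (S : sorting) : seq (tname S) -> proc S -> Prop :=
| wb_outC p bs : isC p -> all (@isA S) bs ->
    wb_typed [:: (p, TO)] (out p bs)
| wb_outO x bs p : isO x -> all (@isA S) bs -> isC p ->
    wb_typed [:: (p, TO)] (out x (rcons bs p))
| wb_outI u bs : isI u -> all (@isA S) bs ->
    wb_typed [::] (out u bs)
| wb_inC q bs p P : isC q -> all (@isA S) bs -> uniq bs -> isC p -> p != q ->
    wb_typed [:: (p, TO)] P ->
    wb_typed [:: (q, TI); (p, TO)] (PGrd (inp q bs P))
| wb_inO x bs p P : isO x -> all (@isA S) bs -> uniq bs -> isC p ->
    wb_typed [:: (p, TO)] P ->
    wb_typed [::] (PGrd (inp x (rcons bs p) P))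
| wb_rep x bs p P : isO x -> all (@isA S) bs -> uniq bs -> isC p ->
    wb_typed [:: (p, TO)] P ->
    wb_typed [::] (rep x (rcons bs p) P)
| wb_inI u bs p P : isI u -> all (@isA S) bs -> uniq bs -> isC p ->
    wb_typed [:: (p, TO)] P ->
    wb_typed [:: (p, TO)] (PGrd (inp u bs P))
| wb_nil : wb_typed [::] (PGrd GNil)
| wb_nuC xi p s P : isC p ->
    (xi = [::] \/ exists xi' q, xi = rcons xi' (q, TI)) ->
    wb_typed (xi ++ [:: (p, TO), (p, TI) & s]) P ->
    wb_typed (xi ++ s) (nu p P)
| wb_nuC' s p P : isC p -> p \notin names s ->
    wb_typed s P -> wb_typed s (nu p P)
| wb_nuA s a P : isA a -> wb_typed s P -> wb_typed s (nu a P)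
| wb_match a b G : isA a -> isA b ->
    wb_typed [::] (PGrd G) -> wb_typed [::] (PGrd (mtch a b G))
| wb_par s s1 s2 P Q : wb_typed s1 P -> wb_typed s2 Q ->
    interleaving s s1 s2 -> wb_typed s (PPar P Q)
| wb_tau s P : size s <= 1 -> wb_typed s P -> wb_typed s (PGrd (GTau P))
| wb_sum s G G' : size s <= 1 -> wb_typed s (PGrd G) ->
    wb_typed s (PGrd G') -> wb_typed s (PGrd (GSum G G')).

Definition wb_step (S : sorting) (s : seq (tname S)) (P : proc S)
    (m : label S) (P' : proc S) : Prop :=
  [/\ wb_typed s P, seq_step (seq_of s) P m P'
    & forall p : name S, isC p -> p \in fn_label m -> p \in names s ->
        exists t s', s = (p, t) :: s' /\
          (p \in names s' -> subj m <> Some p)].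

(* The last clause makes explicit that the stack is left unchanged by the
   visible actions covered by no other clause, i.e. those that mention no
   continuation name. *)
Record conf_step (S : sorting) (s : seq (tname S)) (P : proc S)
    (m : label S) (s' : seq (tname S)) (P' : proc S) : Prop := ConfStep {
  cs_step : wb_step s P m P';
  cs_outC : forall cs p bs, isC p -> m = LOut cs p bs -> s = (p, TO) :: s';
  cs_inC : forall p bs, isC p -> m = LIn p bs -> s = (p, TI) :: s';
  cs_extr : forall cs a bs p, isA a -> isC p ->
    m = LOut cs a (rcons bs p) -> p \in cs -> s' = (p, TI) :: s;
  cs_outA : forall cs a bs p, isA a -> isC p ->
    m = LOut cs a (rcons bs p) -> p \notin cs -> s = (p, TO) :: s';
  cs_inA : forall a bs p, isA a -> isC p ->
    m = LIn a (rcons bs p) -> s' = (p, TO) :: s;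
  cs_tau_pop : forall p s'', m = LTau ->
    s = [:: (p, TO), (p, TI) & s''] -> p \notin fn P' -> s' = s'';
  cs_tau : m = LTau ->
    ~ (exists p s'', s = [:: (p, TO), (p, TI) & s''] /\ p \notin fn P') ->
    s' = s;
  cs_other : m <> LTau -> all (@isA S) (nm_label m) -> s' = s
}.

(* Main.v *)
Require Import Defs.
From mathcomp Require Import all_boot.

(* The tags of a stack alternate and end with an output, so seq_of is the excess
   of outputs over inputs and is additive over interleavings: in P | Q at most
   one component has a stack starting with an output. Hence an output of P at, or
   carrying, a free continuation name p always has p^O at the head of the stack
   of P, and extruding p leaves P with p^I on top. In a communication at p, the
   condition that p^I immediately follows p^O puts p^I at the head of the
   receiver's stack, so that both tags are popped together; in a communication
   carrying p, the tag p^O moves from the sender's stack to the receiver's. Each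
   kind of transition is thus described by a relation between stacks that is
   stable under interleaving and restriction. The side conditions on typed
   transitions are only needed for inputs, which are chosen by the environment. *)

Set Implicit Arguments.
Unset Strict Implicit.
Unset Printing Implicit Defensive.

Scheme proc_grd_ind := Induction for proc Sort Prop
with grd_proc_ind := Induction for grd Sort Prop.
Combined Scheme proc_grd_mutind from proc_grd_ind, grd_proc_ind.

Section Names.
Context {S : sorting}.
Local Notation sorts := (map (@nsort S)).
Implicit Types (a b p q : name S) (bs cs l L : seq (name S)).

Lemma isO_isA a : isO a -> isA a.
Proof. by rewrite /isO /isA /isC; case: kind. Qed.

Lemma isI_isA a : isI a -> isA a.
Proof. by rewrite /isI /isA /isC; case: kind. Qed.

Lemma isI_NisO a : isI a -> ~~ isO a.
Proof. by rewrite /isI /isO; case: kind. Qed.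

Lemma isC_NisO a : isC a -> ~~ isO a.
Proof. by rewrite /isC /isO; case: kind. Qed.

Lemma eq_nsort_kind a b : nsort a = nsort b ->
  (isA a = isA b) * (isC a = isC b) * (isO a = isO b) * (isI a = isI b).
Proof. by rewrite /isA /isC /isO /isI => ->. Qed.

Lemma eq_nsort_all_isA bs cs : sorts bs = sorts cs ->
  all (@isA S) bs = all (@isA S) cs.
Proof.
by elim: bs cs => [|b bs IH] [|c cs] //= [/eq_nsort_kind E /IH ->]; rewrite E.
Qed.

Lemma map_nsort_rcons cs bs p :
  sorts cs = sorts (rcons bs p) ->
  exists cs' q, [/\ cs = rcons cs' q, sorts cs' = sorts bs
                  & nsort q = nsort p].
Proof.
case/lastP: cs => [|cs q]; last first.
  by rewrite !map_rcons => /rcons_inj [E Eq]; exists cs, q.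
by move/(congr1 size); rewrite !size_map size_rcons.
Qed.

Lemma isC_eqF p a : isC p -> isA a -> (p == a) = false.
Proof. by move=> pC aA; apply: contraTF aA => /eqP <-; rewrite /isA pC. Qed.

Lemma isC_memF p bs : isC p -> all (@isA S) bs -> (p \in bs) = false.
Proof. by move=> pC /allP bsA; apply/negP => /bsA; rewrite /isA pC. Qed.

Variant wb_object a : seq (name S) -> Prop :=
| PlainObject bs of ~~ isO a & all (@isA S) bs : wb_object a bs
| ContObject bs p of isO a & all (@isA S) bs & isC p : wb_object a (rcons bs p).

Lemma wb_object_cont_uniq a bs p q : wb_object a bs ->
  p \in a :: bs -> q \in a :: bs -> isC p -> isC q -> p = q.
Proof.
case=> {bs} [bs _ bsA|bs r aO bsA _].
  suff eq_subj b : b \in a :: bs -> isC b -> b = a.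
    by move=> /eq_subj pE /eq_subj qE /pE -> /qE ->.
  by rewrite inE => /orP [/eqP //|b_bs bC]; rewrite (isC_memF bC bsA) in b_bs.
suff eq_last b : b \in a :: rcons bs r -> isC b -> b = r.
  by move=> /eq_last pE /eq_last qE /pE -> /qE ->.
move=> + bC; rewrite inE mem_rcons inE (isC_eqF bC (isO_isA aO)).
by rewrite (isC_memF bC bsA) orbF => /eqP.
Qed.

Lemma fresh_names L bs : exists bs', [/\ uniq bs',
  sorts bs' = sorts bs & forall a, a \in L -> a \notin bs'].
Proof.
pose N := (\max_(a <- L) a.2).+1; pose ids := iota N (size bs).
have sz : size (sorts bs) = size ids by rewrite size_map size_iota.
have snd_zip : map snd (zip (sorts bs) ids) = ids.
  by rewrite -/unzip2 unzip2_zip // sz.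
exists (zip (sorts bs) ids); split.
- by apply: (@map_uniq _ _ snd); rewrite snd_zip iota_uniq.
- by rewrite -[LHS]/(unzip1 _) unzip1_zip // sz.
- move=> a aL; apply/negP => /(map_f snd); rewrite snd_zip mem_iota.
  by case/andP => + _; rewrite /N ltnNge (leq_bigmax_seq a).
Qed.

End Names.

Section Syntax.
Context {S : sorting}.
Local Notation sorts := (map (@nsort S)).
Implicit Types (a b c p q : name S) (bs cs l L : seq (name S)) (o : occ S).
Implicit Types (P Q : proc S) (G : grd S) (f g : name S -> name S).

Definition sort_preserving f := forall a, nsort (f a) = nsort a.

Lemma all_isA_map f bs : sort_preserving f ->
  all (@isA S) (map f bs) = all (@isA S) bs.
Proof.
move=> fS; rewrite all_map; apply: eq_all => a /=.
by rewrite (eq_nsort_kind (fS a)).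
Qed.

Definition rebind f bs bs' a := nth (f a) bs' (index a bs).

Lemma rebind_notin f bs bs' a : size bs' = size bs -> a \notin bs ->
  rebind f bs bs' a = f a.
Proof. by move=> sz ab; rewrite /rebind nth_default // memNindex // sz. Qed.

Lemma rebind_rcons f bs bs' p q : size bs' = size bs -> p \notin bs ->
  rebind f (rcons bs p) (rcons bs' q) p = q.
Proof.
move=> sz pN; rewrite /rebind -(cats1 bs) index_cat (negPf pN) /= eqxx addn0.
by rewrite -sz nth_rcons ltnn eqxx.
Qed.

Lemma rebind1E f c c' a :
  rebind f [:: c] [:: c'] a = if a == c then c' else f a.
Proof. by rewrite /rebind /= eq_sym; case: eqP. Qed.

Lemma sort_preserving_rebind f bs bs' : sorts bs' = sorts bs ->
  sort_preserving f -> sort_preserving (rebind f bs bs').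
Proof.
move=> + fS a; rewrite /rebind.
elim: bs bs' => [|b bs IH] [|b' bs'] //= [Eb /IH {}IH].
by case: eqP => [<-|_].
Qed.

Lemma rebind1_inj f c c' L :
  {in [predD1 L & c] &, injective f} ->
  (forall a, a \in [predD1 L & c] -> f a != c') ->
  {in c :: L &, injective (rebind f [:: c] [:: c'])}.
Proof.
move=> fI fc' a b; rewrite !inE !rebind1E.
have [-> _|ac aL] := eqVneq a c; have [-> _|bc bL] := eqVneq b c => //.
- by move/esym/eqP; rewrite (negPf (fc' b _)) // !inE bc.
- by move/eqP; rewrite (negPf (fc' a _)) // !inE ac.
- by apply: fI; rewrite !inE ?ac ?bc.
Qed.

Lemma close_occ_inj_rebind k bs bs' cs o o' :
  size cs = size bs -> size cs = size bs' ->
  close_occ k bs o = close_occ k bs' o' ->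
  ren_occ (rebind id bs cs) o = ren_occ (rebind id bs' cs) o'.
Proof.
have disjoint_ranges i l l' a : size l' = size l -> a \in l ->
    Bd S (k + index a l) <> if i < k then Bd S i else Bd S (i + size l').
  move=> szl al; case: ltnP => ik [E].
    by rewrite -E ltnNge leq_addr in ik.
  have : k + index a l < i + size l' by rewrite szl -addnS leq_add // index_mem.
  by rewrite E ltnn.
case: o o' => [a|i] [b|j] sz sz' //=.
- case: ifPn => abs; case: ifPn => bbs //= [].
    move/addnI => E; rewrite /rebind -E (set_nth_default b) //.
    by rewrite sz index_mem.
  by move=> E; rewrite -{b}E in bbs *; rewrite !rebind_notin.
- case: ifP => [abs /disjoint_ranges ne|_]; last by case: ifP.
  by case: ne; rewrite -?sz.
- move/esym; case: ifP => [bbs /disjoint_ranges ne|_]; last by case: ifP.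
  by case: ne; rewrite -?sz.
- rewrite -sz -sz'; case: ltnP => ik; case: ltnP => jk [E]; rewrite ?E //.
  + by rewrite E ltnNge (leq_trans jk (leq_addr _ _)) in ik.
  + by rewrite -E ltnNge (leq_trans ik (leq_addr _ _)) in jk.
  + by rewrite (addIn E).
Qed.

Lemma close_inj_psubst bs bs' cs : size cs = size bs -> size cs = size bs' ->
  forall P k Q, close k bs P = close k bs' Q ->
  psubst bs cs P = psubst bs' cs Q.
Proof.
move=> sz sz'; rewrite /psubst -/(rebind id bs cs) -/(rebind id bs' cs).
have eq_occ k o o' := @close_occ_inj_rebind k bs bs' cs o o' sz sz'.
suff [procE _] :
  (forall P k Q, close k bs P = close k bs' Q ->
    ren (rebind id bs cs) P = ren (rebind id bs' cs) Q) /\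
  (forall G k H, close_grd k bs G = close_grd k bs' H ->
    ren_grd (rebind id bs cs) G = ren_grd (rebind id bs' cs) H) by exact: procE.
apply: proc_grd_mutind => /=
  [o os|o ss P IH|P IHP Q IHQ|ss P IH|G IH||o ss P IH|P IH
  |o o' G IH|G IHG H IHH] k [] //=.
- move=> o' os' [/eq_occ -> E]; congr POut.
  by elim: os os' E => [|c os IH] [|c' os'] //= [/eq_occ -> /IH ->].
- by move=> o' ss' P' [/eq_occ -> ->] /IH ->.
- by move=> P' Q' [/IHP -> /IHQ ->].
- by move=> ss' P' [-> /IH ->].
- by move=> G' [/IH ->].
- by move=> o' ss' P' [/eq_occ -> ->] /IH ->.
- by move=> P' [/IH ->].
- by move=> c c' G' [/eq_occ -> /eq_occ -> /IH ->].
- by move=> G' H' [/IHG -> /IHH ->].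
Qed.

Lemma ren_id f P : f =1 id -> ren f P = P.
Proof.
move=> fE; have occE o : ren_occ f o = o by case: o => //= a; rewrite fE.
suff [procE _] : (forall P, ren f P = P) /\ (forall G, ren_grd f G = G).
  exact: procE.
apply: proc_grd_mutind => //=
  [o os|o ss {}P ->|{}P -> Q ->|s {}P ->|G ->|o ss {}P ->|{}P ->
  |o o' G ->|G -> G' ->]; rewrite ?occE //.
by rewrite (eq_map occE) map_id.
Qed.

Lemma psubst_id bs P : psubst bs bs P = P.
Proof.
apply: ren_id => a; have [ab|ab] := boolP (a \in bs); first exact: nth_index.
by rewrite nth_default // memNindex.
Qed.

Lemma mem_fn_close_occ k bs a o :
  (a \in fn_occ (close_occ k bs o)) = (a \in fn_occ o) && (a \notin bs).
Proof.
case: o => [b|i] /=; last by case: ifP.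
by case: ifP => /= bbs; rewrite ?inE; case: eqP => //= ->; rewrite bbs.
Qed.

Lemma mem_fn_close bs a P k :
  (a \in fn (close k bs P)) = (a \in fn P) && (a \notin bs).
Proof.
suff [procE _] :
  (forall P k, (a \in fn (close k bs P)) = (a \in fn P) && (a \notin bs)) /\
  (forall G k, (a \in fn_grd (close_grd k bs G)) =
     (a \in fn_grd G) && (a \notin bs)) by exact: procE.
apply: proc_grd_mutind => //=
  [o os|o ss {}P IH|{}P IHP Q IHQ|o ss {}P IH|o o' G IH|G IH G' IH'] {}k;
  rewrite ?mem_cat ?mem_fn_close_occ ?IH ?IH' ?IHP ?IHQ -?andb_orl //.
rewrite andb_orl; congr orb.
by elim: os => //= o' os IH; rewrite !mem_cat mem_fn_close_occ IH andb_orl.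
Qed.

Lemma mem_fn_inp p a bs P :
  (p \in fn (PGrd (inp a bs P))) = (p == a) || (p \in fn P) && (p \notin bs).
Proof. by rewrite /= inE mem_fn_close. Qed.

Lemma mem_fn_rep p a bs P :
  (p \in fn (rep a bs P)) = (p \in fn (PGrd (inp a bs P))).
Proof. by []. Qed.

Lemma mem_fn_nu p c P : (p \in fn (nu c P)) = (p \in fn P) && (p != c).
Proof. by rewrite /= mem_fn_close inE. Qed.

Lemma mem_fn_out p a bs : (p \in fn (out a bs)) = (p \in a :: bs).
Proof.
by rewrite /= !inE; congr orb; elim: bs => //= b bs IH; rewrite !inE IH.
Qed.

Lemma ren_out f a bs : ren f (out a bs) = out (f a) (map f bs).
Proof. by rewrite /out /= -!map_comp. Qed.

Lemma ren_close f bs bs' P k : size bs' = size bs -> uniq bs' ->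
  all (fun a => (a \in bs) || (f a \notin bs')) (fn P) ->
  ren f (close k bs P) = close k bs' (ren (rebind f bs bs') P).
Proof.
move=> sz U; set avoids := fun a => _.
have occE j o : all avoids (fn_occ o) ->
    ren_occ f (close_occ j bs o) =
      close_occ j bs' (ren_occ (rebind f bs bs') o).
  case: o => [a|i] /=; last by case: ifP => //= _; rewrite sz.
  rewrite andbT /avoids; case: ifPn => /= [abs _|abs /negPf fabs]; last first.
    by rewrite rebind_notin // fabs.
  have i_lt : index a bs < size bs' by rewrite sz index_mem.
  by rewrite /rebind mem_nth // index_uniq.
suff [procE _] :
  (forall P k, all avoids (fn P) ->
     ren f (close k bs P) = close k bs' (ren (rebind f bs bs') P)) /\
  (forall G k, all avoids (fn_grd G) ->
     ren_grd f (close_grd k bs G) =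
       close_grd k bs' (ren_grd (rebind f bs bs') G)).
  exact: procE.
apply: proc_grd_mutind => //=
  [o os|o ss {}P IH|{}P IHP Q IHQ|s {}P IH|G IH|o ss {}P IH|{}P IH
  |o o' G IH|G IHG H IHH] {}k; rewrite ?all_cat.
- case/andP => /occE -> fnos; rewrite -!map_comp; congr POut.
  by elim: os fnos => //= o' os IH; rewrite all_cat => /andP [/occE -> /IH ->].
- by case/andP => /occE -> /IH ->.
- by case/andP => /IHP -> /IHQ ->.
- by move/IH ->.
- by move/IH ->.
- by case/andP => /occE -> /IH ->.
- by move/IH ->.
- by case/and3P => /occE -> /occE -> /IH ->.
- by case/andP => /IHG -> /IHH ->.
Qed.

Lemma ren_close_fresh f bs P L : exists bs',
  [/\ uniq bs', sorts bs' = sorts bs,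
      forall a, a \in L -> a \notin bs'
    & ren f (close 0 bs P) = close 0 bs' (ren (rebind f bs bs') P)].
Proof.
have [bs' [U E fresh]] := fresh_names (L ++ map f (fn P)) bs.
exists bs'; split=> // [a aL|]; first by apply: fresh; rewrite mem_cat aL.
apply: ren_close => //; first by move/(congr1 size): E; rewrite !size_map.
by apply/allP => a aP; rewrite fresh ?orbT // mem_cat map_f ?orbT.
Qed.

Lemma Fr_inj : injective (@Fr S).
Proof. by move=> a b []. Qed.

Lemma out_inj a bs b cs : out a bs = out b cs -> a = b /\ bs = cs.
Proof. by case=> -> /(inj_map Fr_inj). Qed.

End Syntax.
Lemma shuffles0 (T : Type) (l : seq T) : shuffle l l [::].
Proof. by elim: l => [|t l IH]; constructor. Qed.

Lemma shuffleC (T : Type) (l l1 l2 : seq T) :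
  shuffle l l1 l2 -> shuffle l l2 l1.
Proof. by elim=> *; constructor. Qed.

Lemma shuffle_map (T T' : Type) (f : T -> T') (l l1 l2 : seq T) :
  shuffle l l1 l2 -> shuffle (map f l) (map f l1) (map f l2).
Proof. by elim=> *; constructor. Qed.

Lemma shuffle_perm (T : eqType) (l l1 l2 : seq T) :
  shuffle l l1 l2 -> perm_eq l (l1 ++ l2).
Proof.
elim=> //= t r r1 r2 _ IH; last by rewrite perm_cons.
by rewrite -cat1s -[t :: r2]cat1s perm_sym perm_catCA perm_cat2l perm_sym.
Qed.

Lemma shuffle_mem (T : eqType) (l l1 l2 : seq T) :
  shuffle l l1 l2 -> l =i l1 ++ l2.
Proof. by move/shuffle_perm/perm_mem. Qed.

Lemma shuffle_uniq (T : eqType) (l l1 l2 : seq T) (t : T) :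
  shuffle l l1 l2 -> uniq l -> t \in l1 -> t \notin l2.
Proof.
move/shuffle_perm/perm_uniq => ->; rewrite cat_uniq => /and3P [_ /hasPn U _] ts.
by apply: contraTN ts => /U.
Qed.

Lemma shuffle_consE (T : Type) (t : T) (l l1 l2 : seq T) :
  shuffle (t :: l) l1 l2 ->
  (exists2 l1', l1 = t :: l1' & shuffle l l1' l2) \/
  (exists2 l2', l2 = t :: l2' & shuffle l l1 l2').
Proof.
by move=> sh; inversion sh as [|? ? ? l3 sh'|? ? l3 ? sh']; subst; [right|left];
  exists l3.
Qed.

Lemma shuffle_cons_memE (T : eqType) (t : T) (l l1 l2 : seq T) :
  uniq (t :: l) -> shuffle (t :: l) l1 l2 -> t \in l1 ->
  exists2 l1', l1 = t :: l1' & shuffle l l1' l2.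
Proof.
move=> U sh t1; case: (shuffle_consE sh) => // -[l2' E _].
by have := shuffle_uniq sh U t1; rewrite E mem_head.
Qed.

Section Stacks.
Context {S : sorting}.
Implicit Types (a c p q : name S) (cs : seq (name S)) (s xi : seq (tname S)).
Implicit Types (t : tname S).

Lemma namesP p s : reflect (exists b, (p, b) \in s) (p \in names s).
Proof.
apply: (iffP mapP) => [[[q t] ts ->]|[t ts]]; first by exists t.
by exists (p, t).
Qed.

Lemma mem_names p b s : (p, b) \in s -> p \in names s.
Proof. by move=> pbs; apply/namesP; exists b. Qed.

Lemma is_stack_nil : is_stack ([::] : seq (tname S)).
Proof. by split. Qed.

Lemma is_stack_consO p s : is_stack ((p, TO) :: s) <->
  [/\ isC p, is_stack s, seq_of s = 0, (p, TO) \notin s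
    & (p, TI) \in s -> exists s', s = (p, TI) :: s'].
Proof.
split=> [[/=/andP [pC sC] alt lst /andP [pN U] nxt]
        |[pC [sC alt lst U nxt] s0 pN hd]].
  split=> //.
  - split=> //; first by move/path_sorted: alt.
    move=> r rO rI; have := nxt r; rewrite !inE rO rI !orbT /= => /(_ isT isT).
    case/orP => //; rewrite !xpair_eqE andbT => /andP [/eqP rp _].
    by rewrite -rp rO in pN.
  - by case: s alt {lst pN U nxt sC} => [|[q []] s].
  - move=> pI; have := nxt p; rewrite !inE pI eqxx orbT => /(_ isT isT).
    case/orP; last first.
      move/mem_infix => /(_ (p, TO)); rewrite mem_head (negPf pN).
      by move/(_ isT).
    case: s {alt lst pN U nxt sC pI} => // t s /=.
    by rewrite andbC => /andP [_ /eqP <-]; exists s.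
split=> //=.
- by rewrite pC.
- by case: s s0 alt {lst pN U nxt sC hd} => [|[q []] s].
- by rewrite pN.
- move=> r; rewrite !inE !xpair_eqE andbT andbF /=.
  have [-> _ /hd [s' ->]|_ /= rO rI] := eqVneq r p; last by rewrite nxt ?orbT.
  by rewrite /= eqxx prefix0s.
Qed.

Lemma is_stack_consI p s : is_stack ((p, TI) :: s) <->
  [/\ isC p, is_stack s, seq_of s = 1 & p \notin names s].
Proof.
split=> [[/=/andP [pC sC] alt lst /andP [pN U] nxt]
        |[pC [sC alt lst U nxt] s1 pN]].
  split=> //.
  - split=> //; first by move/path_sorted: alt.
      by case: s lst {alt pN U nxt sC}.
    move=> r rO rI; have := nxt r; rewrite !inE rO rI !orbT => /(_ isT isT).
    by rewrite !xpair_eqE andbF.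
  - by case: s alt lst {pN U nxt sC} => [|[q []] s].
  - apply/negP => /namesP [[] ps]; last by rewrite ps in pN.
    have := nxt p; rewrite !inE ps eqxx orbT => /(_ isT isT).
    rewrite xpair_eqE andbF /= => /mem_infix /(_ (p, TI)).
    by rewrite !inE eqxx orbT (negPf pN) => /(_ isT).
split=> //=.
- by rewrite pC.
- by case: s s1 alt {lst pN U nxt sC} => [|[q []] s].
- by case: s s1 lst {alt pN U nxt sC}.
- by rewrite U andbT; apply: contra pN => /mem_names.
- move=> r; rewrite !inE !xpair_eqE andbF andbT /= => rO /orP [/eqP rp|rI].
    by rewrite -rp (mem_names rO) in pN.
  by rewrite nxt ?orbT.
Qed.

Lemma is_stack1 p : isC p -> is_stack [:: (p, TO)].
Proof. by move=> pC; apply/is_stack_consO; split=> //; exact: is_stack_nil. Qed.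

Lemma is_stack_behead t s : is_stack (t :: s) -> is_stack s.
Proof. by case: t => p [] => [/is_stack_consO []|/is_stack_consI []]. Qed.

Lemma stack_names_isC s p : is_stack s -> p \in names s -> isC p.
Proof. by move=> sK; apply/allP: p; exact: stack_cont sK. Qed.

Lemma stack_isA_notin s a : is_stack s -> isA a -> a \notin names s.
Proof. by move=> sK; apply: contraL => /(stack_names_isC sK); rewrite negbK. Qed.

Lemma is_stack_pair p s : is_stack [:: (p, TO), (p, TI) & s] ->
  [/\ isC p, is_stack s, seq_of s = 1 & p \notin names s].
Proof. by case/is_stack_consO => _ /is_stack_consI. Qed.

Lemma stack_consO_names p s : is_stack s -> isC p -> seq_of s = 0 ->
  (p \in names s -> exists b s', s = (p, b) :: s') -> is_stack ((p, TO) :: s).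
Proof.
move=> sK pC s0 hd; apply/is_stack_consO; split=> //.
- apply/negP => pO; have [b [s' Es]] := hd (mem_names pO).
  move: sK s0 pO; rewrite Es; case: b {Es} => // /is_stack_consI [_ _ _ pN] _.
  by rewrite inE xpair_eqE andbF => /mem_names; apply/negP.
- move=> pI; have [b [s' Es]] := hd (mem_names pI); exists s'.
  by move: s0; rewrite Es; case: b {Es}.
Qed.

Lemma stack_split_consO xi p s : is_stack (xi ++ (p, TO) :: s) ->
  xi = [::] \/ exists xi' q, xi = rcons xi' (q, TI).
Proof.
case/lastP: xi => [|xi [q b]]; first by left.
rewrite cat_rcons; case: b => sK; last by right; exists xi, q.
exfalso; elim: xi sK => [/is_stack_consO [] //|t xi IH /is_stack_behead //].
Qed.

Lemma stack_count s : is_stack s ->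
  count (fun t => t.2 == TO) s = count (fun t => t.2 == TI) s + seq_of s.
Proof.
elim: s => //= -[p []] s IH.
  by case/is_stack_consO => _ /IH -> -> _ _; rewrite add0n addn0 addnC.
by case/is_stack_consI => _ /IH -> -> _; rewrite addn0 add0n addnC.
Qed.

Lemma seq_of_le1 s : seq_of s <= 1.
Proof. by case: s => // -[p []]. Qed.

(* In a stack, a name with both tags c^O and c^I has them side by side, so all
   three typing rules for (nu c) read: P is typed under a stack s that is paired
   for c, and (nu c)P under hide [:: c] s. *)
Definition hide cs s := [seq t <- s | t.1 \notin cs].

Definition paired c s := ((c, TO) \in s) == ((c, TI) \in s).

Lemma mem_hide cs s t : (t \in hide cs s) = (t.1 \notin cs) && (t \in s).
Proof. exact: mem_filter. Qed.

Lemma names_hide cs s p :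
  (p \in names (hide cs s)) = (p \notin cs) && (p \in names s).
Proof.
apply/namesP/andP => [[b]|[pN /namesP [b pb]]].
  by rewrite mem_hide => /andP [-> /mem_names].
by exists b; rewrite mem_hide pN.
Qed.

Lemma hide_cons c cs s : hide (c :: cs) s = hide [:: c] (hide cs s).
Proof.
rewrite /hide -filter_predI; apply: eq_filter => t /=.
by rewrite !inE negb_or.
Qed.

Lemma hide_id cs s : (forall p, p \in names s -> p \notin cs) -> hide cs s = s.
Proof. by move=> fresh; apply/all_filterP/allP => -[p b] /mem_names /fresh. Qed.

Lemma hide1_id c s : c \notin names s -> hide [:: c] s = s.
Proof.
by move=> cN; apply: hide_id => p ps; rewrite inE; apply: contraNneq cN => <-.
Qed.

Lemma hide1_cons c p b s : p != c ->
  hide [:: c] ((p, b) :: s) = (p, b) :: hide [:: c] s.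
Proof. by move=> pc; rewrite /hide /= inE pc. Qed.

Lemma paired_notin c s : c \notin names s -> paired c s.
Proof.
move=> cN; have notin b : ((c, b) \in s) = false.
  by apply: contraNF cN; exact: mem_names.
by rewrite /paired !notin.
Qed.

Lemma paired_cons c p b s : p != c -> paired c ((p, b) :: s) = paired c s.
Proof.
by move=> pc; rewrite /paired !inE !xpair_eqE ![c == p]eq_sym (negPf pc).
Qed.

Lemma paired_pair c xi s : paired c (xi ++ [:: (c, TO), (c, TI) & s]).
Proof. by rewrite /paired !mem_cat !inE !eqxx !orbT. Qed.

Lemma hide_pair c xi s : uniq (xi ++ [:: (c, TO), (c, TI) & s]) ->
  hide [:: c] (xi ++ [:: (c, TO), (c, TI) & s]) = xi ++ s.
Proof.
rewrite -[_ :: _ :: s]/([:: _; _] ++ s) uniq_catCA cat_uniq.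
case/and3P => _ /hasPn U _.
rewrite /hide !filter_cat /= !inE eqxx /= -filter_cat -/(hide _ _) hide1_id //.
by apply/namesP => -[[] /U]; rewrite !inE eqxx ?orbT.
Qed.

Lemma paired_head c b s : is_stack ((c, b) :: s) -> paired c ((c, b) :: s) ->
  exists r, [/\ (c, b) :: s = [:: (c, TO), (c, TI) & r], c \notin names r
              & hide [:: c] ((c, b) :: s) = r].
Proof.
case: b => sK; rewrite /paired !inE !xpair_eqE !eqxx /=.
  move=> /eqP/esym cI; have [_ _ _ _ [//|r Es]] := (is_stack_consO c s).1 sK.
  subst s; have [_ _ _ cN] := is_stack_pair sK; exists r.
  by split=> //; apply: (hide_pair (xi := [::])); exact: stack_uniq sK.
by move=> /eqP/mem_names c_in; have [_ _ _ /negP []] := (is_stack_consI c s).1 sK.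
Qed.

Lemma seq_of_hide1 c s : is_stack s -> paired c s ->
  seq_of (hide [:: c] s) = seq_of s.
Proof.
case: s => // -[p b] s sK.
have [pc|pc] := eqVneq p c; last by rewrite hide1_cons.
rewrite {p}pc in sK *; case/paired_head=> // r [E _ ->]; rewrite E in sK *.
by have [_ _ ->] := is_stack_pair sK.
Qed.

Lemma is_stack_hide1 c s : is_stack s -> paired c s -> is_stack (hide [:: c] s).
Proof.
elim: s => // -[p b] s IH sK; have [pc|pc] := eqVneq p c.
  rewrite {p}pc in sK *; case/paired_head=> // r [E _ ->]; rewrite E in sK.
  by have [] := is_stack_pair sK.
rewrite paired_cons // hide1_cons // => c_paired.
have hK := IH (is_stack_behead sK) c_paired.
have s0E := seq_of_hide1 (is_stack_behead sK) c_paired.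
case: b sK => [/is_stack_consO [pC sK s0 pN hd]|/is_stack_consI [pC sK s1 pN]].
  apply/is_stack_consO; split; rewrite ?s0E ?mem_hide ?(negPf pN) ?andbF //.
  by case/andP=> _ /hd [s' ->]; exists (hide [:: c] s'); rewrite hide1_cons.
by apply/is_stack_consI; split; rewrite ?s0E ?names_hide ?(negPf pN) ?andbF.
Qed.

Lemma hide1_eq_consI c p s r : is_stack s -> paired c s ->
  hide [:: c] s = (p, TI) :: r ->
  exists2 s', s = (p, TI) :: s' & hide [:: c] s' = r.
Proof.
case: s => // -[q b] s sK; have [qc|qc] := eqVneq q c.
  rewrite {q}qc in sK *; case/paired_head=> // s' [E _ ->] s'E.
  by rewrite E s'E in sK; have [_ _] := is_stack_pair sK.
by rewrite hide1_cons // => _ [<- <- <-]; exists s.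
Qed.

Lemma is_stack_consO_hide1 c p s : p != c -> is_stack s -> paired c s ->
  is_stack ((p, TO) :: hide [:: c] s) -> is_stack ((p, TO) :: s).
Proof.
move=> pc sK c_paired /is_stack_consO [pC _ s0 pN hd].
rewrite mem_hide inE pc /= in pN; rewrite mem_hide inE pc /= in hd.
apply/is_stack_consO; split=> //; first by rewrite -(seq_of_hide1 sK c_paired).
by case/hd => r /(hide1_eq_consI sK c_paired) [s' -> _]; exists s'.
Qed.

Lemma shuffle_names s s1 s2 :
  shuffle s s1 s2 -> names s =i names s1 ++ names s2.
Proof. by move/(shuffle_map fst)/shuffle_mem. Qed.

Lemma interleavingC s s1 s2 : interleaving s s1 s2 -> interleaving s s2 s1.
Proof. by case=> ? /shuffleC. Qed.

Lemma interleaving_seq_of s s1 s2 : is_stack s1 -> is_stack s2 ->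
  interleaving s s1 s2 -> seq_of s = seq_of s1 + seq_of s2.
Proof.
move=> s1K s2K [sK /shuffle_perm /permP E].
have := stack_count sK; rewrite !E !count_cat (stack_count s1K).
by rewrite (stack_count s2K) addnACA => /eqP; rewrite eqn_add2l => /eqP <-.
Qed.

Lemma interleaving_consO p s s1 s2 : is_stack ((p, TO) :: s1) -> is_stack s2 ->
  interleaving s ((p, TO) :: s1) s2 ->
  exists2 r, s = (p, TO) :: r & interleaving r s1 s2.
Proof.
move=> s1K s2K i; have E := interleaving_seq_of s1K s2K i; case: i E => sK sh E.
have s20 : seq_of s2 = 0.
  by apply/eqP; have := seq_of_le1 s; rewrite E /= ltnS leqn0.
rewrite s20 /= in E; case: s E sK sh => // t s E sK sh.
case: (shuffle_consE sh) => -[r].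
  by case=> <- <- sh'; exists s; split=> //; apply: is_stack_behead sK.
by move=> Es2; rewrite Es2 in s20; case: t E s20 {sK sh Es2} => ? [].
Qed.

Lemma interleaving_consI p s s1 s2 : interleaving ((p, TI) :: s) s1 s2 ->
  p \in names s1 -> exists2 s1', s1 = (p, TI) :: s1' & interleaving s s1' s2.
Proof.
move=> [sK sh] /namesP [b pb]; have [_ _ _ pN] := (is_stack_consI p s).1 sK.
have {}pb : (p, TI) \in s1.
  have := shuffle_mem sh (p, b); rewrite mem_cat pb inE xpair_eqE eqxx /=.
  by case/orP=> [/eqP <- //|/mem_names]; rewrite (negPf pN).
have [s1' -> sh'] := shuffle_cons_memE (stack_uniq sK) sh pb.
by exists s1'; split=> //; apply: is_stack_behead sK.
Qed.

Lemma interleaving_is_stack_consO p s s1 s2 : is_stack s1 -> is_stack s2 ->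
  interleaving s s1 s2 -> is_stack ((p, TO) :: s) -> is_stack ((p, TO) :: s1).
Proof.
move=> s1K s2K i /is_stack_consO [pC _ s0 pN hd].
apply/is_stack_consO; split=> //.
- by apply/eqP; have := interleaving_seq_of s1K s2K i; rewrite s0; case: seq_of.
- by apply: contra pN; rewrite (shuffle_mem i.2) mem_cat => ->.
- move=> pI; have [|s' Es] := hd; first by rewrite (shuffle_mem i.2) mem_cat pI.
  rewrite Es in i; have [s1' -> _] := interleaving_consI i (mem_names pI).
  by exists s1'.
Qed.

Lemma interleaving_moveO p s s1 s2 : is_stack ((p, TO) :: s1) -> is_stack s2 ->
  interleaving s ((p, TO) :: s1) s2 ->
  is_stack ((p, TO) :: s2) /\ interleaving s s1 ((p, TO) :: s2).
Proof.
move=> s1K s2K i; have [r Es ir] := interleaving_consO s1K s2K i; subst s.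
have rK : is_stack ((p, TO) :: r) by case: i.
split; last by case: ir => _ sh; split=> //; apply: sh_r.
exact: interleaving_is_stack_consO s2K (is_stack_behead s1K)
  (interleavingC ir) rK.
Qed.

Lemma interleaving_pair p s s1 s2 : is_stack ((p, TO) :: s1) -> is_stack s2 ->
  interleaving s ((p, TO) :: s1) s2 -> p \in names s2 ->
  exists r s2', [/\ s = [:: (p, TO), (p, TI) & r], s2 = (p, TI) :: s2'
                  & interleaving r s1 s2'].
Proof.
move=> s1K s2K i ps2; have [r Es ir] := interleaving_consO s1K s2K i; subst s.
have [_ _ _ pN hd] := (is_stack_consO p r).1 i.1.
have [b pb] := namesP _ _ ps2.
have pr : (p, b) \in r by rewrite (shuffle_mem ir.2) mem_cat pb orbT.
case: b pr {pb} => pr; first by rewrite pr in pN.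
have [r' Er] := hd pr; subst r.
have [s2' Es2 i'] := interleaving_consI (interleavingC ir) ps2.
by exists r', s2'; split=> //; apply: interleavingC.
Qed.

Lemma interleaving_cons_pair p s s1 s2 :
  is_stack ((p, TI) :: s1) -> is_stack s2 -> interleaving s s1 s2 ->
  p \notin names s2 ->
  is_stack ((p, TO) :: s2) /\
  interleaving [:: (p, TO), (p, TI) & s] ((p, TI) :: s1) ((p, TO) :: s2).
Proof.
move=> /is_stack_consI [pC s1K s11 pN1] s2K i pN2; have [sK sh] := i.
have sE := interleaving_seq_of s1K s2K i; rewrite s11 in sE.
have [s2_0 s_1] : seq_of s2 = 0 /\ seq_of s = 1.
  by have := seq_of_le1 s; rewrite sE; case: (seq_of s2).
split; first by apply: stack_consO_names => // ps2; rewrite ps2 in pN2.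
split; last by apply: sh_r; apply: sh_l.
have pN : p \notin names s by rewrite (shuffle_names sh) mem_cat negb_or pN1.
apply/is_stack_consO; split=> //; last by exists s.
  by apply/is_stack_consI.
by rewrite inE xpair_eqE andbF /=; apply: contra pN => /mem_names.
Qed.

Definition map_stack (f : name S -> name S) s : seq (tname S) :=
  [seq (f t.1, t.2) | t <- s].

Lemma names_map_stack f s : names (map_stack f s) = map f (names s).
Proof. by rewrite /names /map_stack -!map_comp. Qed.

Lemma eq_in_map_stack f g s :
  {in names s, f =1 g} -> map_stack f s = map_stack g s.
Proof. by move=> E; apply/eq_in_map => -[p b] /mem_names /E /= ->. Qed.

Lemma map_stack_id s : map_stack id s = s.
Proof. by rewrite -[RHS]map_id; apply: eq_map => -[]. Qed.

Lemma mem_map_stack f c b s : {in c :: names s &, injective f} ->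
  ((f c, b) \in map_stack f s) = ((c, b) \in s).
Proof.
move=> fI; apply/mapP/idP => [[[a b'] a_in [Ef ->]]|c_in]; last by exists (c, b).
by rewrite (fI _ _ _ _ Ef) ?inE ?eqxx ?(mem_names a_in) ?orbT.
Qed.

Lemma paired_map_stack f c s : {in c :: names s &, injective f} ->
  paired (f c) (map_stack f s) = paired c s.
Proof. by move=> fI; rewrite /paired !mem_map_stack. Qed.

Lemma hide1_map_stack f c s : {in c :: names s &, injective f} ->
  hide [:: f c] (map_stack f s) = map_stack f (hide [:: c] s).
Proof.
move=> fI; rewrite /hide filter_map; congr map.
apply: eq_in_filter => -[a b] /mem_names a_in; rewrite /= !inE.
by rewrite (inj_in_eq fI) ?inE ?eqxx ?a_in ?orbT.
Qed.

Lemma is_stack_map f s : sort_preserving f ->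
  {in names s &, injective f} -> is_stack s -> is_stack (map_stack f s).
Proof.
move=> fS fI [sC alt lst U nxt]; split.
- rewrite names_map_stack all_map; apply: sub_all sC => a /=.
  by rewrite (eq_nsort_kind (fS a)).
- by rewrite sorted_map.
- by rewrite -map_comp.
- rewrite map_inj_in_uniq // => -[p t] [q u] /mem_names ps /mem_names qs.
  by case=> /(fI _ _ ps qs) -> ->.
- move=> _ /mapP [[p []] // pO [->]] /mapP [[q []] // qI [E]].
  have Epq := fI _ _ (mem_names pO) (mem_names qI) E; subst q.
  have /infixP [l [r ->]] := nxt p pO qI.
  apply/infixP; exists (map_stack f l), (map_stack f r).
  by rewrite /map_stack !map_cat.
Qed.

End Stacks.

Section Typing.
Context {S : sorting}.
Local Notation sorts := (map (@nsort S)).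
Implicit Types (a b c p q : name S) (bs cs L : seq (name S)).
Implicit Types (P Q R : proc S) (G : grd S) (f g : name S -> name S).
Implicit Types (s xi : seq (tname S)) (m : label S).

Lemma wb_typed_is_stack s P : wb_typed s P -> is_stack s.
Proof.
elim=> {s P};
  do ?by move=> *; first [exact: is_stack_nil|exact: is_stack1|assumption].
- move=> q bs p P qC _ _ pC pq _ pK; apply/is_stack_consI; split=> //.
  by rewrite inE eq_sym.
- move=> xi p s P _ _ _ sK; rewrite -(hide_pair (stack_uniq sK)).
  by apply: is_stack_hide1 sK _; exact: paired_pair.
- by move=> s s1 s2 P Q _ _ _ _ [].
Qed.

Lemma wb_typed_mem_fn s P p : wb_typed s P -> isC p ->
  (p \in fn P) = (p \in names s).
Proof.
move=> sP pC; elim: sP => {s P}.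
- by move=> q bs qC bsA; rewrite mem_fn_out !inE (isC_memF pC bsA) orbF.
- move=> x bs q xO bsA qC; rewrite mem_fn_out inE mem_rcons !inE.
  by rewrite (isC_memF pC bsA) (isC_eqF pC (isO_isA xO)) orbF.
- move=> u bs uI bsA; rewrite mem_fn_out inE.
  by rewrite (isC_memF pC bsA) (isC_eqF pC (isI_isA uI)).
- move=> q bs r P qC bsA _ rC _ _ IH.
  by rewrite mem_fn_inp IH (isC_memF pC bsA) andbT !inE.
- move=> x bs r P xO bsA _ rC _ IH; rewrite mem_fn_inp IH mem_rcons !inE.
  by rewrite (isC_memF pC bsA) orbF andbN (isC_eqF pC (isO_isA xO)).
- move=> x bs r P xO bsA _ rC _ IH.
  rewrite mem_fn_rep mem_fn_inp IH mem_rcons !inE.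
  by rewrite (isC_memF pC bsA) orbF andbN (isC_eqF pC (isO_isA xO)).
- move=> u bs r P uI bsA _ rC _ IH; rewrite mem_fn_inp IH (isC_memF pC bsA).
  by rewrite andbT (isC_eqF pC (isI_isA uI)).
- by [].
- move=> xi q s P qC _ sP IH.
  rewrite mem_fn_nu IH -(hide_pair (stack_uniq (wb_typed_is_stack sP))).
  by rewrite names_hide inE andbC.
- move=> s q P qC qN _ IH; rewrite mem_fn_nu IH.
  by have [->|] := eqVneq p q; rewrite ?(negPf qN) // andbT.
- by move=> s a P aA _ IH; rewrite mem_fn_nu IH (isC_eqF pC aA) andbT.
- move=> a b G aA bA _ /= IH.
  by rewrite !inE IH (isC_eqF pC aA) (isC_eqF pC bA).
- move=> s s1 s2 P Q _ IHP _ IHQ [_ sh] /=.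
  by rewrite mem_cat IHP IHQ (shuffle_names sh) mem_cat.
- by [].
- by move=> s G G' _ _ IH _ IH' /=; rewrite mem_cat IH IH' orbb.
Qed.

Lemma wb_typed_names_fn s P : wb_typed s P -> {subset names s <= fn P}.
Proof.
move=> sP p ps; rewrite (wb_typed_mem_fn sP) //.
exact: stack_names_isC (wb_typed_is_stack sP) ps.
Qed.

Lemma wb_nu c s P : paired c s -> wb_typed s P ->
  wb_typed (hide [:: c] s) (nu c P).
Proof.
move=> /eqP c_paired sP; have sK := wb_typed_is_stack sP.
have [/namesP [b cb]|cN] := boolP (c \in names s); last first.
  rewrite hide1_id //; have [cC|cA] := boolP (isC c); first exact: wb_nuC'.
  exact: wb_nuA.
have [cO cI] : (c, TO) \in s /\ (c, TI) \in s.
  by rewrite c_paired; case: b cb; rewrite -?c_paired.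
have cC : isC c := stack_names_isC sK (mem_names cO).
have /infixP [xi [s' Es]] := stack_next sK cO cI.
rewrite Es /= in sP sK *; rewrite (hide_pair (stack_uniq sK)).
apply: wb_nuC sP => //; exact: stack_split_consO sK.
Qed.

Lemma wb_nus cs s P : (forall c, c \in cs -> paired c s) -> wb_typed s P ->
  wb_typed (hide cs s) (nus cs P).
Proof.
move=> + sP; elim: cs => [|c cs IH] paired_cs /=; first by rewrite hide_id.
rewrite hide_cons; apply: wb_nu; last first.
  by apply: IH => b bcs; apply: paired_cs; rewrite inE bcs orbT.
by rewrite /paired !mem_hide (eqP (paired_cs c (mem_head _ _))).
Qed.

(* Injectivity is only required on the continuation names of P: early inputs
   may identify the other names. *)
Definition ren_stable s P := forall f, sort_preserving f ->
  {in names s &, injective f} -> wb_typed (map_stack f s) (ren f P).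

Lemma ren_stable1 p P f : sort_preserving f -> ren_stable [:: (p, TO)] P ->
  wb_typed [:: (f p, TO)] (ren f P).
Proof. by move=> fS; apply=> // a b; rewrite !inE => /eqP -> /eqP ->. Qed.

Lemma ren_close_free_cont f bs p P : sort_preserving f ->
  all (@isA S) bs -> isC p -> ren_stable [:: (p, TO)] P ->
  exists bs' Q, [/\ uniq bs', sorts bs' = sorts bs,
    wb_typed [:: (f p, TO)] Q & ren f (close 0 bs P) = close 0 bs' Q].
Proof.
move=> fS bsA pC rP; have [bs' [U E _ ->]] := ren_close_fresh f bs P [::].
exists bs', (ren (rebind f bs bs') P); split=> //.
have sz : size bs' = size bs by move/(congr1 size): E; rewrite !size_map.
rewrite -(rebind_notin f sz (negbT (isC_memF pC bsA))).
by apply: ren_stable1 => //; apply: sort_preserving_rebind.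
Qed.

Lemma ren_close_bound_cont f bs p P : sort_preserving f ->
  all (@isA S) bs -> isC p -> ren_stable [:: (p, TO)] P ->
  exists bs' p' Q, [/\ uniq bs', sorts (rcons bs' p') = sorts (rcons bs p),
    all (@isA S) bs' && isC p', wb_typed [:: (p', TO)] Q
    & ren f (close 0 (rcons bs p) P) = close 0 (rcons bs' p') Q].
Proof.
move=> fS bsA pC rP.
have [l [U E _ ->]] := ren_close_fresh f (rcons bs p) P [::].
have [bs' [p' [El E' Ep]]] := map_nsort_rcons E; subst l.
exists bs', p', (ren (rebind f (rcons bs p) (rcons bs' p')) P); split=> //.
- by move: U; rewrite rcons_uniq => /andP [].
- by rewrite (eq_nsort_all_isA E') bsA (eq_nsort_kind Ep).
- have sz : size bs' = size bs by move/(congr1 size): E'; rewrite !size_map.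
  rewrite -{1}(rebind_rcons f p' sz (negbT (isC_memF pC bsA))).
  by apply: ren_stable1 => //; apply: sort_preserving_rebind.
Qed.

Lemma ren_stable_nu c s P : paired c s -> ren_stable s P ->
  ren_stable (hide [:: c] s) (nu c P).
Proof.
move=> c_paired rP f fS fI /=.
have [l [_ E fresh ->]] := ren_close_fresh f [:: c] P (map f (names s)).
case: l E fresh => [|c' [|? ?]] //= [Ec] fresh.
set g := rebind f [:: c] [:: c'].
have gS : sort_preserving g by apply: sort_preserving_rebind; rewrite //= Ec.
have gI : {in c :: names s &, injective g}.
  apply: rebind1_inj => [a b|a]; rewrite !inE => /andP [ac a_in].
    by case/andP=> bc b_in; apply: fI; rewrite names_hide inE ?ac ?bc.
  by have := fresh (f a); rewrite map_f // inE => ->.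
have gc : g c = c' by rewrite /g rebind1E eqxx.
have -> : map_stack f (hide [:: c] s) = hide [:: c'] (map_stack g s).
  rewrite -gc hide1_map_stack //; apply: eq_in_map_stack => a.
  by rewrite names_hide inE /g rebind1E => /andP [/negPf ->].
rewrite -Ec; apply: wb_nu; first by rewrite -gc paired_map_stack.
by apply: rP => //; apply: sub_in2 gI => a a_in; rewrite inE a_in orbT.
Qed.

Lemma ren_stable_nu_fresh c s P : c \notin names s -> ren_stable s P ->
  ren_stable s (nu c P).
Proof.
by move=> cN; rewrite -{2}(hide1_id cN); exact/ren_stable_nu/paired_notin.
Qed.

Lemma ren_stable_par s s1 s2 P Q : interleaving s s1 s2 ->
  ren_stable s1 P -> ren_stable s2 Q -> ren_stable s (PPar P Q).
Proof.
move=> [sK sh] rP rQ f fS fI.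
have [sub1 sub2] : {subset names s1 <= names s} /\ {subset names s2 <= names s}.
  by split=> a am; rewrite (shuffle_names sh) mem_cat am ?orbT.
apply: (@wb_par _ _ (map_stack f s1) (map_stack f s2)).
- by apply: rP => //; apply: sub_in2 fI.
- by apply: rQ => //; apply: sub_in2 fI.
- by split; [exact: is_stack_map|exact: shuffle_map].
Qed.

Lemma wb_typed_ren s P : wb_typed s P -> ren_stable s P.
Proof.
elim=> {s P}.
- move=> p bs pC bsA f fS _; rewrite ren_out.
  by apply: wb_outC; rewrite ?all_isA_map ?(eq_nsort_kind (fS p)).
- move=> x bs p xO bsA pC f fS _; rewrite ren_out map_rcons.
  by apply: wb_outO; rewrite ?all_isA_map ?(eq_nsort_kind (fS _)).
- move=> u bs uI bsA f fS _; rewrite ren_out.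
  by apply: wb_outI; rewrite ?all_isA_map ?(eq_nsort_kind (fS u)).
- move=> q bs p P qC bsA _ pC pq _ rP f fS fI /=.
  have [bs' [Q [U E hQ ->]]] := ren_close_free_cont fS bsA pC rP; rewrite -E.
  apply: wb_inC; rewrite ?(eq_nsort_kind (fS _)) ?(eq_nsort_all_isA E) //.
  by apply: contraNneq pq => /fI ->; rewrite ?inE ?eqxx ?orbT.
- move=> x bs p P xO bsA _ pC _ rP f fS _ /=.
  have [bs' [p' [Q [U <- /andP [bsA' pC'] hQ ->]]]] :=
    ren_close_bound_cont fS bsA pC rP.
  by apply: wb_inO; rewrite ?(eq_nsort_kind (fS _)).
- move=> x bs p P xO bsA _ pC _ rP f fS _ /=.
  have [bs' [p' [Q [U <- /andP [bsA' pC'] hQ ->]]]] :=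
    ren_close_bound_cont fS bsA pC rP.
  by apply: wb_rep; rewrite ?(eq_nsort_kind (fS _)).
- move=> u bs p P uI bsA _ pC _ rP f fS _ /=.
  have [bs' [Q [U E hQ ->]]] := ren_close_free_cont fS bsA pC rP; rewrite -E.
  by apply: wb_inI; rewrite ?(eq_nsort_kind (fS _)) ?(eq_nsort_all_isA E).
- by move=> f _ _; apply: wb_nil.
- move=> xi p s P _ _ sP rP.
  rewrite -(hide_pair (stack_uniq (wb_typed_is_stack sP))).
  exact: ren_stable_nu (paired_pair _ _ _) rP.
- by move=> s p P _ pN _; exact: ren_stable_nu_fresh.
- move=> s a P aA sP; apply: ren_stable_nu_fresh.
  exact: stack_isA_notin (wb_typed_is_stack sP) aA.
- move=> a b G aA bA _ rG f fS fI.
  by apply: wb_match; rewrite ?(eq_nsort_kind (fS _)) //; apply: rG.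
- by move=> s s1 s2 P Q _ rP _ rQ i; apply: ren_stable_par i rP rQ.
- by move=> s P sz _ rP f fS fI; apply: wb_tau; [rewrite size_map|apply: rP].
- move=> s G G' sz _ rG _ rG' f fS fI.
  by apply: wb_sum; [rewrite size_map|apply: rG|apply: rG'].
Qed.

Lemma wb_typed_psubst p P bs cs : sorts cs = sorts bs ->
  wb_typed [:: (p, TO)] P ->
  wb_typed [:: (rebind id bs cs p, TO)] (psubst bs cs P).
Proof.
by move=> E /wb_typed_ren; apply: (@ren_stable1 _ _ (rebind id bs cs));
  apply: sort_preserving_rebind.
Qed.

Lemma wb_typed_nu_alpha c P p Q s :
  nu c P = nu p Q -> wb_typed s Q -> paired p s ->
  exists s', [/\ wb_typed s' P, paired c s' & hide [:: c] s' = hide [:: p] s].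
Proof.
case=> Es Ec sQ p_paired; pose f := rebind id [:: p] [:: c].
have -> : P = ren f Q.
  by rewrite -[LHS](psubst_id [:: c]); exact: close_inj_psubst Ec.
have c_fresh : c \in fn Q -> c = p.
  move=> cQ; have := mem_fn_close [:: c] c P 0.
  by rewrite Ec mem_fn_close cQ !inE eqxx andbF /= => /negbFE /eqP.
have fI : {in p :: names s &, injective f}.
  apply: rebind1_inj => // a; rewrite !inE => /andP [ap a_in].
  apply: contraNneq ap => Ea.
  by rewrite Ea c_fresh // -Ea (wb_typed_names_fn sQ).
have fp : f p = c by rewrite /f rebind1E eqxx.
exists (map_stack f s); split.
- apply: wb_typed_ren => //.
    by apply: sort_preserving_rebind; rewrite //= Es.
  by apply: sub_in2 fI => a a_in; rewrite inE a_in orbT.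
- by rewrite -fp paired_map_stack.
- rewrite -fp hide1_map_stack // -[RHS]map_stack_id.
  apply: eq_in_map_stack => a.
  by rewrite names_hide inE /f rebind1E => /andP [/negPf ->].
Qed.

Lemma wb_nu_inv s c P : wb_typed s (nu c P) ->
  exists s0, [/\ wb_typed s0 P, paired c s0 & hide [:: c] s0 = s].
Proof.
move ER : (nu c P) => R sR; case: sR ER => // {s R}.
- move=> xi p s Q _ _ sQ E.
  rewrite -(hide_pair (stack_uniq (wb_typed_is_stack sQ))).
  exact: wb_typed_nu_alpha E sQ (paired_pair _ _ _).
- move=> s p Q _ pN sQ E; rewrite -(hide1_id pN).
  exact: wb_typed_nu_alpha E sQ (paired_notin pN).
- move=> s p Q pA sQ E.
  have pN := stack_isA_notin (wb_typed_is_stack sQ) pA.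
  rewrite -(hide1_id pN); exact: wb_typed_nu_alpha E sQ (paired_notin pN).
Qed.

Lemma wb_par_inv s P Q : wb_typed s (PPar P Q) -> exists s1 s2,
  [/\ wb_typed s1 P, wb_typed s2 Q & interleaving s s1 s2].
Proof.
move ER : (PPar P Q) => R sR; case: sR ER => // r s1 s2 P0 Q0 sP sQ i [-> ->].
by exists s1, s2.
Qed.

Lemma wb_match_inv s a b G :
  wb_typed s (PGrd (mtch a b G)) -> wb_typed s (PGrd G).
Proof. by move ER : (PGrd _) => R sR; case: sR ER => // ? ? ? _ _ ? [_ _ ->]. Qed.

Lemma wb_sum_inv s G G' : wb_typed s (PGrd (GSum G G')) ->
  wb_typed s (PGrd G) /\ wb_typed s (PGrd G').
Proof. by move ER : (PGrd _) => R sR; case: sR ER => // ? ? ? _ ? ? [-> ->]. Qed.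

Lemma wb_tau_inv s P : wb_typed s (PGrd (GTau P)) -> wb_typed s P.
Proof. by move ER : (PGrd _) => R sR; case: sR ER => // ? ? _ ? [->]. Qed.

Lemma wb_rep_inv s u bs P : wb_typed s (rep u bs P) ->
  s = [::] /\ wb_typed [::] (PGrd (inp u bs P)).
Proof.
rewrite /inp; move ER : (rep u bs P) => R sR; case: sR ER => // {s R}.
by move=> x cs p Q xO csA U pC sQ [-> -> ->]; split=> //; apply: wb_inO.
Qed.

End Typing.

Section Transitions.
Context {S : sorting}.
Local Notation sorts := (map (@nsort S)).
Implicit Types (a b c p q : name S) (bs cs : seq (name S)).
Implicit Types (P Q : proc S) (G : grd S) (s : seq (tname S)) (m : label S).

(* EmitReturn is a communication at p. In EmitExtrude the process had the stack
   p^O, p^I, s before the extrusion of p, so s starts with an output. *)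
Variant stack_emit m s s' : Prop :=
| EmitKeep of all (@isA S) (nm_label m) & s' = s
| EmitReturn p of m = LTau & s = [:: (p, TO), (p, TI) & s']
| EmitPop p of isC p & p \in fn_label m & s = (p, TO) :: s'
| EmitExtrude p of isC p & p \in bn_label m & seq_of s = 1 & s' = (p, TI) :: s.

Variant stack_recv a bs s s' : Prop :=
| RecvKeep of all (@isA S) (a :: bs) & s' = s
| RecvPop of isC a & s = (a, TI) :: s'
| RecvPush p of isC p & p \in bs & s' = (p, TO) :: s.

Lemma stack_emit_par m s s1 s1' s2 : stack_emit m s1 s1' ->
  is_stack s1 -> is_stack s1' -> is_stack s2 -> interleaving s s1 s2 ->
  (forall c, c \in bn_label m -> c \notin names s2) ->
  exists2 s', stack_emit m s s' & interleaving s' s1' s2.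
Proof.
move=> em s1K s1K' s2K i fresh.
case: em => [mA ->|p mE E|p pC pm E|p pC pm s11 E].
- by exists s => //; apply: EmitKeep.
- rewrite E in s1K i; have [pK ip] := interleaving_moveO s1K s2K i.
  have [|r [s1'' [-> [<-] ir]]] :=
    interleaving_pair pK (is_stack_behead s1K) (interleavingC ip).
    by rewrite /= inE eqxx.
  by exists r; [apply: EmitReturn|apply: interleavingC].
- rewrite E in s1K i; have [r -> ir] := interleaving_consO s1K s2K i.
  by exists r => //; apply: EmitPop pm erefl.
- rewrite E in s1K' *; exists ((p, TI) :: s).
    apply: (EmitExtrude pC) => //; apply/eqP; rewrite eqn_leq seq_of_le1.
    by rewrite (interleaving_seq_of s1K s2K i) s11 leq_addr.
  have [_ [/is_stack_behead sK' _]] :=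
    interleaving_cons_pair s1K' s2K i (fresh _ pm).
  by split=> //; apply: sh_l i.2.
Qed.

Lemma stack_emit_hide m c s s' :
  stack_emit m s s' -> is_stack s -> paired c s -> c \notin nm_label m ->
  stack_emit m (hide [:: c] s) (hide [:: c] s') /\ paired c s'.
Proof.
move=> em sK c_paired cm; have neq_c p : p \in nm_label m -> p != c.
  by apply: contraTneq => ->.
case: em => [mA ->|p mE E|p pC pm E|p pC pm s1 E].
- by split=> //; apply: EmitKeep.
- rewrite E in sK c_paired *; have [_ _ _ pN] := is_stack_pair sK.
  have [pc|pc] := eqVneq p c.
    rewrite {p E}pc in sK c_paired pN *; split; last exact: paired_notin.
    rewrite (hide_pair (xi := [::]) (stack_uniq sK)) hide1_id //.
    by apply: EmitKeep; rewrite ?mE.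
  rewrite !paired_cons // in c_paired; rewrite !hide1_cons //.
  by split=> //; apply: (EmitReturn (p := p)).
- have pc : p != c by apply: neq_c; move: pm; rewrite mem_filter => /andP [].
  rewrite E paired_cons // in c_paired; rewrite E hide1_cons //.
  by split=> //; apply: EmitPop pm erefl.
- have pc : p != c.
    by apply: neq_c; case: (m) pm => //= ? ? ? pm; rewrite mem_cat pm.
  rewrite E paired_cons // hide1_cons //; split=> //.
  by apply: EmitExtrude pm _ erefl => //; rewrite seq_of_hide1.
Qed.

Lemma stack_emit_open cs a bs c s s' : stack_emit (LOut cs a bs) s s' ->
  is_stack s -> paired c s -> wb_object a bs -> {subset cs <= bs} ->
  c \in bs -> c \notin cs ->
  stack_emit (LOut (c :: cs) a bs) (hide [:: c] s) s'.
Proof.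
move=> em sK c_paired ab_obj sub cbs ccs.
have cont_c p : isC c -> p \in cs ++ a :: bs -> isC p -> p = c.
  move=> cC pm pC; apply: wb_object_cont_uniq ab_obj _ _ pC cC; last first.
    by rewrite inE cbs orbT.
  by move: pm; rewrite mem_cat => /orP [/sub pbs|//]; rewrite inE pbs orbT.
have hide_c : ~~ isC c -> hide [:: c] s = s.
  by move/(stack_isA_notin sK)/hide1_id.
case: em => [mA ->|//|p pC|p pC pcs s1 ->].
- have cA : isA c by apply: (allP mA); rewrite /= mem_cat inE cbs !orbT.
  by rewrite hide_c //; apply: EmitKeep => //=; rewrite cA.
- rewrite mem_filter /= => /andP [pcs pm] E; have [pc|pc] := eqVneq p c.
    rewrite {p pcs pm}pc in pC E; rewrite E in sK c_paired *.
    have [r [[Es'] _ ->]] := paired_head sK c_paired; rewrite Es' in sK *.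
    have [_ _ r1 _] := is_stack_pair sK.
    by apply: (EmitExtrude pC) => //=; rewrite inE eqxx.
  rewrite hide_c; last by apply: contra_neqN pc => cC; exact: cont_c.
  by apply: (EmitPop pC) E; rewrite mem_filter /= !inE negb_or pc pcs pm orbT.
- have pc : p != c by apply: contraNneq ccs => <-.
  rewrite hide_c; last first.
    by apply: contra_neqN pc => cC; apply: cont_c; rewrite // mem_cat pcs.
  by apply: (EmitExtrude pC) => //=; rewrite inE pcs orbT.
Qed.

Lemma stack_recv_functional a bs s s1 s2 : wb_object a bs ->
  stack_recv a bs s s1 -> stack_recv a bs s s2 -> s1 = s2.
Proof.
move=> ab_obj.
have noA p : isC p -> p \in a :: bs -> ~~ all (@isA S) (a :: bs).
  by move=> pC pm; apply: contraL pm => abA; rewrite (isC_memF pC).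
have no_both p : isC a -> isC p -> p \in bs -> False.
  case: ab_obj => {bs noA} [bs _ bsA _ pC|bs q aO _ _ /isC_NisO].
    by rewrite (isC_memF pC).
  by rewrite aO.
case=> [abA1 ->|aC1 E1|p1 pC1 pm1 ->]; case=> [abA2 ->|aC2 E2|p2 pC2 pm2 ->] //.
- by have := noA a aC2 (mem_head _ _); rewrite abA1.
- by have := noA p2 pC2; rewrite inE pm2 orbT abA1 => /(_ isT).
- by have := noA a aC1 (mem_head _ _); rewrite abA2.
- by move: E1; rewrite E2 => -[].
- by case: (no_both p2).
- by have := noA p1 pC1; rewrite inE pm1 orbT abA2 => /(_ isT).
- by case: (no_both p1).
- have -> // : p1 = p2.
  by apply: wb_object_cont_uniq ab_obj _ _ pC1 pC2; rewrite inE ?pm1 ?pm2 orbT.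
Qed.

Lemma stack_recv_par a bs s s' s1 s2 : stack_recv a bs s s' ->
  is_stack s' -> is_stack s1 -> is_stack s2 -> interleaving s s1 s2 ->
  (isC a -> a \in names s1) ->
  exists s1', [/\ stack_recv a bs s1 s1', is_stack s1'
                & interleaving s' s1' s2].
Proof.
move=> rv s'K s1K s2K i as1; case: rv => [abA ->|aC E|p pC pbs E].
- by exists s1; split=> //; apply: RecvKeep.
- rewrite E in i; have [s1' Es1 i'] := interleaving_consI i (as1 aC).
  exists s1'; split=> //; first exact: RecvPop.
  by rewrite Es1 in s1K; exact: is_stack_behead s1K.
- rewrite {}E in s'K *; exists ((p, TO) :: s1); split.
  + exact: RecvPush pbs erefl.
  + exact: interleaving_is_stack_consO s1K s2K i s'K.
  + by split=> //; apply: sh_l i.2.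
Qed.

Lemma stack_recv_hide a bs c s s' : stack_recv a bs (hide [:: c] s) s' ->
  is_stack s' -> is_stack s -> paired c s -> c \notin a :: bs ->
  exists s0, [/\ stack_recv a bs s s0, is_stack s0, paired c s0
               & hide [:: c] s0 = s'].
Proof.
move=> rv s'K sK c_paired; rewrite inE negb_or eq_sym => /andP [ac cbs].
case: rv => [abA ->|aC /(hide1_eq_consI sK c_paired) [s0 E <-]|p pC pbs E].
- by exists s; split=> //; apply: RecvKeep.
- exists s0; rewrite E in sK c_paired *; split=> //; first exact: RecvPop.
    exact: is_stack_behead sK.
  by rewrite paired_cons in c_paired.
- have pc : p != c by apply: contraNneq cbs => <-.
  exists ((p, TO) :: s); rewrite E in s'K *.
  rewrite hide1_cons // paired_cons //.
  split=> //; first exact: RecvPush pbs erefl.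
  exact: is_stack_consO_hide1 pc sK c_paired s'K.
Qed.

Lemma stack_comm_free cs a bs s s1 s1' s2 : stack_emit (LOut cs a bs) s1 s1' ->
  all (@isA S) cs -> is_stack s1 -> is_stack s2 -> interleaving s s1 s2 ->
  (isC a -> a \in names s2) ->
  exists s2' s', [/\ stack_recv a bs s2 s2', is_stack s2',
    interleaving s' s1' s2' & stack_emit LTau s s'].
Proof.
move=> em csA s1K s2K i as2; case: em => [mA ->|//|p pC|p pC pcs _ _].
- exists s2, s; split=> //; last exact: EmitKeep.
  by apply: RecvKeep => //; move: mA; rewrite /= all_cat => /andP [].
- rewrite mem_filter mem_cat /= (isC_memF pC csA) /= inE.
  case/orP=> [/eqP ->|pbs] E.
    rewrite E in s1K i; have [aC _ _ _ _] := (is_stack_consO _ _).1 s1K.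
    have [s' [s2' [Es Es2 i']]] := interleaving_pair s1K s2K i (as2 aC).
    exists s2', s'; split=> //; [exact: RecvPop| |exact: EmitReturn Es].
    by rewrite Es2 in s2K; exact: is_stack_behead s2K.
  rewrite E in s1K i; have [s2K' i'] := interleaving_moveO s1K s2K i.
  exists ((p, TO) :: s2), s.
  by split=> //; [exact: RecvPush pbs erefl|exact: EmitKeep].
- by rewrite (isC_memF pC csA) in pcs.
Qed.

Lemma stack_comm_extrude p cs a bs s s1 s1' s2 :
  stack_emit (LOut cs a bs) s1 s1' -> isC p -> p \in cs ->
  wb_object a bs -> {subset cs <= bs} ->
  is_stack s1' -> is_stack s2 -> interleaving s s1 s2 -> p \notin names s2 ->
  exists s2', [/\ stack_recv a bs s2 s2', is_stack s2'
                & interleaving [:: (p, TO), (p, TI) & s] s1' s2'].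
Proof.
move=> em pC pcs ab_obj sub s1K' s2K i pN; have pbs := sub p pcs.
have eq_p q : isC q -> q \in a :: bs -> q = p.
  move=> qC qm; apply: wb_object_cont_uniq ab_obj qm _ qC pC.
  by rewrite inE pbs orbT.
case: em => [mA _|//|q qC|q qC qcs _ E].
- by have := allP mA p; rewrite /isA pC /= mem_cat pcs => /(_ isT).
- rewrite mem_filter mem_cat /= => /andP [qcs /orP [|/(eq_p _ qC) Eq]].
    by rewrite (negPf qcs).
  by rewrite Eq pcs in qcs.
- have Eq : q = p by apply: eq_p; rewrite // inE sub ?orbT.
  rewrite Eq in E; rewrite E in s1K' *.
  have [s2K' i'] := interleaving_cons_pair s1K' s2K i pN.
  by exists ((p, TO) :: s2); split=> //; exact: RecvPush pbs erefl.
Qed.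

(* After the communication, s2' is the stack of the receiver and s0 that of the
   parallel composition under the binders cs. *)
Lemma stack_comm cs a bs s s1 s1' s2 : stack_emit (LOut cs a bs) s1 s1' ->
  is_stack s1 -> is_stack s1' -> is_stack s2 -> interleaving s s1 s2 ->
  wb_object a bs -> {subset cs <= bs} ->
  (isC a -> a \in names s2) -> (forall c, c \in cs -> c \notin names s2) ->
  exists s2' s0, [/\ stack_recv a bs s2 s2', is_stack s2',
    interleaving s0 s1' s2', forall c, c \in cs -> paired c s0
    & stack_emit LTau s (hide cs s0)].
Proof.
move=> em s1K s1K' s2K i ab_obj sub as2 fresh.
have [csA|/allPn [p pcs /negbNE pC]] := boolP (all (@isA S) cs).
  have [s2' [s0 [rv s2K' i' em']]] := stack_comm_free em csA s1K s2K i as2.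
  have csN c : c \in cs -> c \notin names s0.
    by move/(allP csA); apply: stack_isA_notin i'.1.
  exists s2', s0; split=> // [c /csN/paired_notin //|].
  by rewrite hide_id // => q; apply: contraL; exact: csN.
have [s2' [rv s2K' i']] :=
  stack_comm_extrude em pC pcs ab_obj sub s1K' s2K i (fresh p pcs).
have [_ sK _ pN] := is_stack_pair i'.1.
have csN c : c \in cs -> c \notin names s.
  move=> ccs; apply: contra pN => c_in; suff <- : c = p by [].
  have cC := stack_names_isC sK c_in.
  by apply: wb_object_cont_uniq ab_obj _ _ cC pC; rewrite inE sub ?orbT.
exists s2', [:: (p, TO), (p, TI) & s]; split=> // [c ccs|].
  have [->|pc] := eqVneq p c; first exact: (paired_pair _ [::]).
  by rewrite !paired_cons //; apply: paired_notin; exact: csN.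
rewrite /hide /= pcs -/(hide _ _) hide_id => [|q]; first exact: EmitKeep.
by apply: contraL; exact: csN.
Qed.

Definition is_input m : bool := if m is LIn _ _ then true else false.

Lemma extruded_sub P cs a bs P' : step P (LOut cs a bs) P' -> {subset cs <= bs}.
Proof.
move Em : (LOut cs a bs) => m st.
elim: st cs a bs Em => {P m P'} //; try by eauto.
- by move=> a bs _ _ _ [-> _ ->].
- move=> c P cs a bs P' _ IH cb _ _ _ _ _ [-> _ ->] b; rewrite inE.
  by case/orP => [/eqP -> //|]; apply: IH.
Qed.

Lemma step_input_fn P a bs P' : step P (LIn a bs) P' -> a \in fn P.
Proof.
move Em : (LIn a bs) => m st; elim: st a bs Em => {P m P'} //.
- by move=> a bs cs P _ _ _ _ [-> _]; rewrite mem_fn_inp eqxx.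
- by move=> a bs cs P _ _ _ _ [-> _]; rewrite mem_fn_rep mem_fn_inp eqxx.
- by move=> a G m P' _ IH b bs /IH ? /=; rewrite !inE; apply/or3P; apply: Or33.
- by move=> G G' m P' _ IH a bs /IH ? /=; rewrite mem_cat; apply/orP; left.
- by move=> G G' m P' _ IH a bs /IH ? /=; rewrite mem_cat; apply/orP; right.
- by move=> P Q m P' _ IH _ a bs /IH ? /=; rewrite mem_cat; apply/orP; left.
- by move=> P Q m Q' _ IH _ a bs /IH ? /=; rewrite mem_cat; apply/orP; right.
- move=> c P m P' _ IH cN a bs E; rewrite mem_fn_nu (IH _ _ E) /=.
  by apply: contraNneq cN => <-; rewrite -E mem_head.
Qed.

Definition wb_label m : Prop :=
  match m with
  | LTau => True
  | LIn a bs => wb_object a bs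
  | LOut _ a bs => wb_object a bs
  end.

Lemma wb_typed_out_emit s a bs : wb_typed s (out a bs) ->
  wb_object a bs /\
  exists2 s', stack_emit (LOut [::] a bs) s s' & wb_typed s' (PGrd GNil).
Proof.
move ER : (out a bs) => R sR; case: sR ER => // {s R}.
- move=> p cs pC csA /out_inj [-> ->].
  split; first by apply: PlainObject => //; apply: isC_NisO.
  exists [::]; last exact: wb_nil.
  by apply: (EmitPop pC) => //; rewrite mem_filter mem_head.
- move=> x cs p xO csA pC /out_inj [-> ->]; split; first exact: ContObject.
  exists [::]; last exact: wb_nil.
  by apply: (EmitPop pC) => //; rewrite mem_filter inE mem_rcons mem_head orbT.
- move=> u cs uI csA /out_inj [-> ->].
  split; first by apply: PlainObject => //; apply: isI_NisO.
  by exists [::]; [apply: EmitKeep; rewrite //= isI_isA|exact: wb_nil].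
Qed.

Lemma wb_typed_inst p bs bs' cs P Q :
  sorts bs = sorts bs' -> close 0 bs P = close 0 bs' Q ->
  sorts cs = sorts bs' -> wb_typed [:: (p, TO)] Q ->
  wb_typed [:: (rebind id bs' cs p, TO)] (psubst bs cs P).
Proof.
move=> Ebs Ec Ecs sQ; have szc := congr1 size Ecs; have szb := congr1 size Ebs.
rewrite !size_map in szc szb.
by rewrite (close_inj_psubst _ szc Ec) ?szb //; exact: wb_typed_psubst.
Qed.

Lemma wb_typed_inp_recv s a bs cs P : sorts cs = sorts bs ->
  wb_typed s (PGrd (inp a bs P)) ->
  wb_object a cs /\
  exists2 s', stack_recv a cs s s' & wb_typed s' (psubst bs cs P).
Proof.
move=> Ecs; move ER : (PGrd _) => R sR; case: sR ER => // {s R}.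
- move=> q bs' p Q qC bsA _ pC _ sQ [-> E Ec]; have Ecs' := etrans Ecs E.
  split; first by apply: PlainObject; rewrite ?isC_NisO ?(eq_nsort_all_isA Ecs').
  have sz : size cs = size bs' by move/(congr1 size): Ecs'; rewrite !size_map.
  exists [:: (p, TO)]; first exact: RecvPop.
  by have := wb_typed_inst E Ec Ecs' sQ; rewrite rebind_notin ?(isC_memF pC bsA).
- move=> x bs' p Q xO bsA _ pC sQ [-> E Ec]; have Ecs' := etrans Ecs E.
  have [cs' [q [Eq E' qp]]] := map_nsort_rcons Ecs'; rewrite {}Eq in Ecs' *.
  have qC : isC q by rewrite (eq_nsort_kind qp).
  have sz : size cs' = size bs' by move/(congr1 size): E'; rewrite !size_map.
  split; first by apply: ContObject; rewrite ?(eq_nsort_all_isA E').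
  exists [:: (q, TO)].
    by apply: RecvPush qC _ erefl; rewrite mem_rcons mem_head.
  by have := wb_typed_inst E Ec Ecs' sQ; rewrite rebind_rcons ?(isC_memF pC bsA).
- move=> u bs' p Q uI bsA _ pC sQ [-> E Ec]; have Ecs' := etrans Ecs E.
  have csA : all (@isA S) cs by rewrite (eq_nsort_all_isA Ecs').
  split; first by apply: PlainObject; rewrite ?isI_NisO.
  have sz : size cs = size bs' by move/(congr1 size): Ecs'; rewrite !size_map.
  exists [:: (p, TO)]; first by apply: RecvKeep; rewrite //= isI_isA.
  by have := wb_typed_inst E Ec Ecs' sQ; rewrite rebind_notin ?(isC_memF pC bsA).
Qed.

Lemma step_wb_label s P m P' : step P m P' -> wb_typed s P -> wb_label m.
Proof.
move=> st; elim: st s => {P m P'} //=.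
- by move=> a bs s /wb_typed_out_emit [].
- by move=> a bs cs P _ E s /(wb_typed_inp_recv E) [].
- by move=> a bs cs P _ E s /wb_rep_inv [_ /(wb_typed_inp_recv E) []].
- by move=> a G m P' _ IH s /wb_match_inv /IH.
- by move=> G G' m P' _ IH s /wb_sum_inv [/IH].
- by move=> G G' m P' _ IH s /wb_sum_inv [_ /IH].
- by move=> P Q m P' _ IH _ s /wb_par_inv [s1 [s2 [/IH]]].
- by move=> P Q m Q' _ IH _ s /wb_par_inv [s1 [s2 [_ /IH]]].
- by move=> c P m P' _ IH _ s /wb_nu_inv [s0 [/IH]].
- by move=> c P cs a bs P' _ IH _ _ _ s /wb_nu_inv [s0 [/IH]].
Qed.

Lemma step_input_cont s P a bs P' : step P (LIn a bs) P' -> wb_typed s P ->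
  isC a -> a \in names s.
Proof. by move=> /step_input_fn aP sP aC; rewrite -(wb_typed_mem_fn sP). Qed.

Lemma disj_names cs s P : disj cs (fn P) -> wb_typed s P ->
  forall c, c \in cs -> c \notin names s.
Proof.
by move=> /hasPn dj sP c /dj; apply: contra => /(wb_typed_names_fn sP).
Qed.

(* An early input may receive a continuation name that cannot be pushed on s,
   hence the hypothesis that s' is a stack. *)
Lemma step_wb_recv s s' P a bs P' : step P (LIn a bs) P' -> wb_typed s P ->
  stack_recv a bs s s' -> is_stack s' -> wb_typed s' P'.
Proof.
move Em : (LIn a bs) => m st; elim: st a bs Em s s' => {P m P'} //.
- move=> a bs cs P _ E _ _ [-> ->] s s' sP rv _.
  have [a_obj [r rv' rP]] := wb_typed_inp_recv E sP.
  by rewrite (stack_recv_functional a_obj rv rv').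
- move=> a bs cs P _ E _ _ [-> ->] s s' sP rv s'K.
  have [Es sP'] := wb_rep_inv sP.
  rewrite Es in sP rv; have [a_obj [r rv' rP]] := wb_typed_inp_recv E sP'.
  rewrite -(stack_recv_functional a_obj rv rv') in rP.
  by apply: wb_par rP sP _; split=> //; exact: shuffles0.
- by move=> a G m P' _ IH b bs Em s s' /wb_match_inv; exact: IH.
- by move=> G G' m P' _ IH b bs Em s s' /wb_sum_inv [+ _]; exact: IH.
- by move=> G G' m P' _ IH b bs Em s s' /wb_sum_inv [_]; exact: IH.
- move=> P Q m P' st IH _ a bs Em s s' /wb_par_inv [s1 [s2 [sP sQ i]]] rv s'K.
  have [s1K s2K] := (wb_typed_is_stack sP, wb_typed_is_stack sQ).
  rewrite -Em in st; have [s1' [rv' s1K' i']] :=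
    stack_recv_par rv s'K s1K s2K i (step_input_cont st sP).
  exact: wb_par (IH _ _ Em _ _ sP rv' s1K') sQ i'.
- move=> P Q m Q' st IH _ a bs Em s s' /wb_par_inv [s1 [s2 [sP sQ i]]] rv s'K.
  have [s1K s2K] := (wb_typed_is_stack sP, wb_typed_is_stack sQ).
  rewrite -Em in st; have [s2' [rv' s2K' i']] :=
    stack_recv_par rv s'K s2K s1K (interleavingC i) (step_input_cont st sQ).
  exact: wb_par sP (IH _ _ Em _ _ sQ rv' s2K') (interleavingC i').
- move=> c P m P' _ IH cN a bs Em s s' /wb_nu_inv [s0 [sP c_paired E]] rv s'K.
  rewrite -E in rv; rewrite -Em in cN.
  have [s0' [rv' s0K' c_paired' <-]] :=
    stack_recv_hide rv s'K (wb_typed_is_stack sP) c_paired cN.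
  exact: wb_nu c_paired' (IH _ _ Em _ _ sP rv' s0K').
Qed.

Lemma step_comm s s1 s1' s2 cs a bs P P' Q Q' : step P (LOut cs a bs) P' ->
  step Q (LIn a bs) Q' -> disj cs (fn Q) -> wb_typed s1 P -> wb_typed s2 Q ->
  interleaving s s1 s2 -> stack_emit (LOut cs a bs) s1 s1' -> wb_typed s1' P' ->
  exists s2' s0, [/\ wb_typed s2' Q', interleaving s0 s1' s2',
    forall c, c \in cs -> paired c s0 & stack_emit LTau s (hide cs s0)].
Proof.
move=> stP stQ dj sP sQ i em sP'.
have ab_obj : wb_object a bs := step_wb_label stP sP.
have [s2' [s0 [rv s2K' i' ps em']]] :=
  stack_comm em (wb_typed_is_stack sP) (wb_typed_is_stack sP')
    (wb_typed_is_stack sQ) i ab_obj (extruded_sub stP)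
    (step_input_cont stQ sQ) (disj_names dj sQ).
by exists s2', s0; split=> //; exact: step_wb_recv stQ sQ rv s2K'.
Qed.

Lemma step_wb_emit s P m P' : step P m P' -> ~~ is_input m -> wb_typed s P ->
  exists2 s', stack_emit m s s' & wb_typed s' P'.
Proof.
move=> st; elim: st s => {P m P'} //.
- by move=> a bs s _ /wb_typed_out_emit [].
- by move=> P s _ /wb_tau_inv sP; exists s => //; apply: EmitKeep.
- by move=> a G m P' _ IH s mN /wb_match_inv; exact: IH.
- by move=> G G' m P' _ IH s mN /wb_sum_inv [+ _]; exact: IH.
- by move=> G G' m P' _ IH s mN /wb_sum_inv [_]; exact: IH.
- move=> P Q m P' _ IH dj s mN /wb_par_inv [s1 [s2 [sP sQ i]]].
  have [s1' em sP'] := IH _ mN sP.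
  have [s' em' i'] := stack_emit_par em (wb_typed_is_stack sP)
    (wb_typed_is_stack sP') (wb_typed_is_stack sQ) i (disj_names dj sQ).
  by exists s' => //; exact: wb_par sP' sQ i'.
- move=> P Q m Q' _ IH dj s mN /wb_par_inv [s1 [s2 [sP sQ i]]].
  have [s2' em sQ'] := IH _ mN sQ.
  have [s' em' i'] := stack_emit_par em (wb_typed_is_stack sQ)
    (wb_typed_is_stack sQ') (wb_typed_is_stack sP) (interleavingC i)
    (disj_names dj sP).
  by exists s' => //; exact: wb_par sP sQ' (interleavingC i').
- move=> P Q cs a bs P' Q' stP IH stQ _ dj s _ /wb_par_inv [s1 [s2 [sP sQ i]]].
  have [s1' em sP'] := IH _ isT sP.
  have [s2' [s0 [sQ' i' ps em']]] := step_comm stP stQ dj sP sQ i em sP'.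
  by exists (hide cs s0) => //; exact: wb_nus ps (wb_par sP' sQ' i').
- move=> P Q cs a bs P' Q' stP _ stQ IH dj s _ /wb_par_inv [s1 [s2 [sP sQ i]]].
  have [s2' em sQ'] := IH _ isT sQ.
  have [s1' [s0 [sP' i' ps em']]] :=
    step_comm stQ stP dj sQ sP (interleavingC i) em sQ'.
  exists (hide cs s0) => //.
  exact: wb_nus ps (wb_par sP' sQ' (interleavingC i')).
- move=> c P m P' _ IH cN s mN /wb_nu_inv [s0 [sP c_paired <-]].
  have [s0' em sP'] := IH _ mN sP.
  have [em' c_paired'] := stack_emit_hide em (wb_typed_is_stack sP) c_paired cN.
  by exists (hide [:: c] s0') => //; exact: wb_nu.
- move=> c P cs a bs P' st IH cb cN _ s _ /wb_nu_inv [s0 [sP c_paired <-]].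
  have [s0' em sP'] := IH _ isT sP; exists s0' => //.
  exact: stack_emit_open em (wb_typed_is_stack sP) c_paired (step_wb_label st sP)
    (extruded_sub st) cb cN.
Qed.

Lemma conf_step_tau s s' s'' P P' : conf_step s P LTau s' P' ->
  stack_emit LTau s s'' -> wb_typed s P -> wb_typed s'' P' -> s' = s''.
Proof.
move=> st em sP sP'; have sK := wb_typed_is_stack sP.
case: em => [_ E|p _ E|p pC|p pC] //.
  rewrite E in sP' *; apply: (cs_tau st) => // -[p [r [Es /negP []]]].
  rewrite Es in sK sP'; have [pC _ _ _] := is_stack_pair sK.
  by rewrite (wb_typed_mem_fn sP' pC) mem_head.
rewrite E in sK; have [pC _ _ pN] := is_stack_pair sK.
by apply: (cs_tau_pop st) E _; rewrite // (wb_typed_mem_fn sP' pC).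
Qed.

Lemma conf_step_out s s' s'' cs a bs P P' :
  conf_step s P (LOut cs a bs) s' P' -> stack_emit (LOut cs a bs) s s'' ->
  wb_object a bs -> {subset cs <= bs} -> s' = s''.
Proof.
move=> st em ab_obj sub; case: em => [mA ->|//|p pC|p pC pcs _ ->].
- exact: cs_other st _ mA.
- rewrite mem_filter mem_cat /= => /andP [pcs]; rewrite (negPf pcs) /=.
  case: ab_obj st {sub} => {bs} [bs _ bsA|bs q aO bsA _] st.
    rewrite inE (isC_memF pC bsA) orbF => /eqP pa Es; rewrite -pa in st.
    by have := cs_outC st pC erefl; rewrite Es => -[].
  rewrite inE mem_rcons inE (isC_eqF pC (isO_isA aO)) (isC_memF pC bsA) orbF.
  move/eqP=> pq Es; rewrite -pq in st.
  by have := cs_outA st (isO_isA aO) pC erefl pcs; rewrite Es => -[].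
- rewrite /= in pcs; have pbs := sub p pcs.
  case: ab_obj st pbs {sub} => {bs} [bs _ bsA|bs q aO bsA _] st.
    by rewrite (isC_memF pC bsA).
  rewrite mem_rcons inE (isC_memF pC bsA) orbF => /eqP pq; rewrite -pq in st.
  by rewrite (cs_extr st (isO_isA aO) pC erefl pcs).
Qed.

Lemma conf_step_in s s' a bs P P' : conf_step s P (LIn a bs) s' P' ->
  wb_object a bs -> is_stack s -> stack_recv a bs s s' /\ is_stack s'.
Proof.
move=> st ab_obj sK; case: ab_obj st => {bs} [bs aO bsA|bs p aO bsA pC] st.
  have [aC|aA] := boolP (isC a).
    have Es := cs_inC st aC erefl; split; first exact: RecvPop.
    by rewrite Es in sK; exact: is_stack_behead sK.
  have abA : all (@isA S) (a :: bs) by rewrite /= bsA andbT.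
  by rewrite (cs_other st) //; split=> //; apply: RecvKeep.
have Es := cs_inA st (isO_isA aO) pC erefl.
have [_ [_ _ allowed] guard] := cs_step st.
split; first by apply: RecvPush pC _ Es; rewrite mem_rcons mem_head.
rewrite Es; apply: stack_consO_names => // [|ps].
  by case: allowed => // -[_ /= /isI_NisO]; rewrite aO.
have [|b [r [-> _]]] := guard p pC _ ps; last by exists b, r.
by rewrite mem_filter inE mem_rcons mem_head orbT.
Qed.

End Transitions.

Theorem mainTheorem9 (S : sorting) (s s' : seq (tname S)) (P P' : proc S)
    (m : label S) (hP : well_sorted P) (hs : wb_typed s P)
    (hstep : conf_step s P m s' P') : wb_typed s' P'.
Proof.
case: m hstep => [|a bs|cs a bs] hstep; have [_ [_ st _] _] := cs_step hstep.
- have [s'' em hs''] := step_wb_emit st isT hs.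
  by rewrite (conf_step_tau hstep em hs hs'').
- have a_obj : wb_object a bs := step_wb_label st hs.
  have [rv s'K] := conf_step_in hstep a_obj (wb_typed_is_stack hs).
  exact: step_wb_recv st hs rv s'K.
- have [s'' em hs''] := step_wb_emit st isT hs.
  by rewrite (conf_step_out hstep em (step_wb_label st hs) (extruded_sub st)).
Qed.
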